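(* Let $\Omega\subset\mathbb{R}^d$ be a bounded domain. There exist constants $\lambda_{refined}=\lambda_{refined}(\overline{\overline{\Omega}})>0$, not depending on $\delta$, and $\overline{\lambda}>0$, depending on neither $\overline{\overline{\Omega}}$ nor $\delta$, such that for all sufficiently small $\delta>0$, $$\lambda_{refined}\,\delta^{d+2}\le\frac{a(u,u)}{\|u\|^2_{L_2(\overline{\overline{\Omega}})}}\le\overline{\lambda}\,\delta^d\qquad\text{for all } u\in L_{2,0}(\overline{\overline{\Omega}}),\ u\neq 0.$$ Moreover, let $K$ be the stiffness matrix produced by the finite element discretization of $a(\cdot,\cdot)$. Then the condition number of $K$ satisfies $$\kappa(K)\lesssim\delta^{-2},$$ where the implied constant is independent of $\delta$ and of the mesh size $h$.
   Context: Functions are real-valued (scalar). Let $\delta>0$ (the horizon). The canonical kernel is $\chi_\delta(\mathbf{x}-\mathbf{x}')=1$ if $\|\mathbf{x}-\mathbf{x}'\|\le\delta$ (Euclidean norm) and $0$ otherwise. The nonlocal boundary of $\Omega$ is the region of thickness $\delta$ surrounding $\Omega$, $\mathcal{B}\Omega=\{\mathbf{x}\in\mathbb{R}^d\setminus\Omega:\operatorname{dist}(\mathbf{x},\Omega)\le\delta\}$, and the nonlocal closure of $\Omega$ is $\overline{\overline{\Omega}}:=\Omega\cup\mathcal{B}\Omega$. Set $L_{2,0}(\overline{\overline{\Omega}}):=\{v\in L_2(\overline{\overline{\Omega}}): v|_{\mathcal{B}\Omega}=0\}$. The bilinear form is $$a(u,v)=\frac12\int_{\overline{\overline{\Omega}}}\int_{\overline{\overline{\Omega}}}\chi_\delta(\mathbf{x}-\mathbf{x}')\,[u(\mathbf{x}')-u(\mathbf{x})]\,[v(\mathbf{x}')-v(\mathbf{x})]\,d\mathbf{x}'\,d\mathbf{x}.$$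 Independence of $\lambda_{refined}$ from $\delta$ means that, for fixed $\Omega$, the same constant works for all sufficiently small $\delta$. Discretization: $\mathcal{T}_h$ is a conforming mesh whose elements are $d$-cubes of side length $h>0$, and $V_h\subset L_{2,0}(\overline{\overline{\Omega}})$ is the finite-dimensional space of piecewise constant or of piecewise linear finite element functions on $\mathcal{T}_h$ vanishing on $\mathcal{B}\Omega$, with its standard basis $\{\phi_j\}$ of shape functions. The stiffness matrix is $K=(a(\phi_j,\phi_i))_{i,j}$. The condition number $\kappa$ of a symmetric positive definite matrix is the ratio of its largest to its smallest eigenvalue. *)

(* Defs.v *)
From HB Require Import structures.
From mathcomp Require Import all_boot all_order all_algebra.
From mathcomp Require Import all_classical all_reals all_analysis.

Set Implicit Arguments.
Unset Strict Implicit.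
Unset Printing Implicit Defensive.

Import Order.TTheory GRing.Theory Num.Theory.
Import numFieldNormedType.Exports.

Local Open Scope classical_set_scope.
Local Open Scope ring_scope.

(* The sigma-algebra on R^n generated by the coordinate maps; as R is second
   countable, this is the Borel sigma-algebra of the topology of 'rV[R]_n. *)
Section measurable_rV.
Context {R : realType} {n : nat}.

Definition rV_coord (i : 'I_n) (x : 'rV[R]_n) : R := x ord0 i.

Let rV_set0 : g_sigma_preimage rV_coord set0.
Proof. exact: sigma_algebra0. Qed.

Let rV_setC A : g_sigma_preimage rV_coord A -> g_sigma_preimage rV_coord (~` A).
Proof. exact: sigma_algebraC. Qed.

Let rV_bigcup (F : (set 'rV[R]_n)^nat) :
  (forall i, g_sigma_preimage rV_coord (F i)) ->
  g_sigma_preimage rV_coord (\bigcup_i (F i)).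
Proof. exact: sigma_algebra_bigcup. Qed.

HB.instance Definition _ := @isMeasurable.Build default_measure_display
  'rV[R]_n (g_sigma_preimage rV_coord) rV_set0 rV_setC rV_bigcup.

Lemma measurable_rV_coord (i : 'I_n) : measurable_fun setT (rV_coord i).
Proof.
move=> _ Y mY; rewrite setTI; apply: sub_sigma_algebra; rewrite -bigcup_seq/=.
by exists i => /=; [rewrite mem_index_enum|exists Y => //; rewrite setTI].
Qed.

Lemma measurable_fun_rV d (T : measurableType d) (f : T -> 'rV[R]_n) :
  (forall i, measurable_fun setT (rV_coord i \o f)) -> measurable_fun setT f.
Proof.
move=> mf _ A mA; rewrite setTI.
suff : preimage_set_system setT f measurable `<=` measurable.
  by apply; exists A => //; rewrite setTI.
rewrite -(g_sigma_preimage_comp rV_coord).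
apply: smallest_sub; first exact: sigma_algebra_measurable.
by rewrite -bigcup_seq => B [i _ [Y mY <-]]; exact: mf.
Qed.

End measurable_rV.

Section lebesgue_rV.
Context {R : realType}.

Definition cons_rV n (p : R * 'rV[R]_n) : 'rV[R]_n.+1 :=
  row_mx (p.1%:M : 'rV[R]_1) p.2.

Definition uncons_rV n (x : 'rV[R]_n.+1) : R * 'rV[R]_n :=
  (x ord0 ord0, rsubmx (x : 'rV[R]_(1 + n))).

Lemma cons_rVK n : cancel (@cons_rV n) (@uncons_rV n).
Proof.
move=> [a x]; rewrite /uncons_rV /cons_rV/=; congr pair; last first.
  exact: (@row_mxKr _ 1 1 n).
have -> : ord0 = lshift n ord0 :> 'I_(1 + n) by exact/val_inj.
by rewrite (@row_mxEl _ 1 1 n) mxE eqxx mulr1n.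
Qed.

Lemma measurable_cons_rV n : measurable_fun setT (@cons_rV n).
Proof.
apply: measurable_fun_rV => i; case: (@splitP 1 n i) => j ij.
  rewrite (_ : _ \o _ = fst)//; apply/funext => x /=.
  have -> : i = lshift n j :> 'I_(1 + n) by exact/val_inj.
  by rewrite /rV_coord /cons_rV (@row_mxEl _ 1 1 n) mxE !ord1 eqxx mulr1n.
rewrite (_ : _ \o _ = rV_coord j \o snd); last first.
  apply/funext => x /=.
  have -> : i = rshift 1 j :> 'I_(1 + n) by exact/val_inj.
  by rewrite /rV_coord /cons_rV (@row_mxEr _ 1 1 n).
by apply: measurableT_comp => //; exact: measurable_rV_coord.
Qed.

Lemma measurable_uncons_rV n : measurable_fun setT (@uncons_rV n).
Proof.
apply/measurable_fun_pairP; split; first exact: (measurable_rV_coord ord0).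
apply: measurable_fun_rV => i.
rewrite (_ : _ \o _ = rV_coord (rshift 1 i : 'I_n.+1)).
  exact: measurable_rV_coord.
by apply/funext => x; rewrite /rV_coord/= mxE.
Qed.

Section lebesgue_rV_step.
Context {n : nat} (m : {sigma_finite_measure set 'rV[R]_n -> \bar R}).

Definition lebesgue_rV_step : set 'rV[R]_n.+1 -> \bar R :=
  pushforward (@lebesgue_measure R \x m)%E (@cons_rV n).

Let mpush : {measure set 'rV[R]_n.+1 -> \bar R} :=
  @measure_function_pushforward__canonical__measure_function_Measure _ _ _ _ _
    (@lebesgue_measure R \x m)%E _ (@measurable_cons_rV n).

Let step0 : lebesgue_rV_step set0 = 0%E. Proof. exact: (measure0 mpush). Qed.

Let step_ge0 A : (0 <= lebesgue_rV_step A)%E.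
Proof. exact: (measure_ge0 mpush). Qed.

Let step_sigma_additive : semi_sigma_additive lebesgue_rV_step.
Proof. exact: (@measure_semi_sigma_additive _ _ _ mpush). Qed.

HB.instance Definition _ := isMeasure.Build _ _ _ lebesgue_rV_step
  step0 step_ge0 step_sigma_additive.

Let step_sigma_finite : sigma_finite setT lebesgue_rV_step.
Proof.
have /sigma_finiteP[F [FT ndF Foo]] := sigma_finiteT (@lebesgue_measure R).
have /sigma_finiteP[G [GT ndG Goo]] := sigma_finiteT m.
exists (fun i => @uncons_rV n @^-1` (F i `*` G i)).
  rewrite -preimage_bigcup; apply/esym/seteqP; split => // x _ /=.
  have [[k _ Fk] [l _ Gl]] : (\bigcup_i F i) (uncons_rV x).1 /\
    (\bigcup_i G i) (uncons_rV x).2 by rewrite -FT -GT.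
  exists (maxn k l) => //; split.
    by move: Fk; exact/subsetPset/ndF/leq_maxl.
  by move: Gl; exact/subsetPset/ndG/leq_maxr.
move=> i; have [mF Fi] := Foo i; have [mG Gi] := Goo i; split.
  rewrite -[X in measurable X]setTI.
  by apply: measurable_uncons_rV => //; exact: measurableX.
rewrite /lebesgue_rV_step /pushforward -comp_preimage.
rewrite (_ : _ \o _ = id); last by apply/funext => x; exact: cons_rVK.
by rewrite preimage_id product_measure1E// lte_mul_pinfty// ge0_fin_numE.
Qed.

HB.instance Definition _ := Measure_isSigmaFinite.Build _ _ _ lebesgue_rV_step
  step_sigma_finite.

End lebesgue_rV_step.

(* n-dimensional Lebesgue measure, as the n-fold product of the one-dimensional
   one; the single point of R^0 has mass 1. *)
Fixpoint lebesgue_rV (n : nat) : 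
    {sigma_finite_measure set 'rV[R]_n -> \bar R} :=
  if n is n'.+1 then lebesgue_rV_step (lebesgue_rV n') else \d_(0 : 'rV[R]_0).

End lebesgue_rV.

Section nonlocal_form.
Context {R : realType} {d : nat}.
Local Notation mu := (@lebesgue_rV R d).
Implicit Types (x z : 'rV[R]_d) (Om A : set 'rV[R]_d) (u v : 'rV[R]_d -> R).

(* The library norm on 'rV[R]_d is the maximum norm; it induces the same
   topology and bounded sets, but the horizon is measured in this one. *)
Definition eucl_norm x : R := Num.sqrt (\sum_i x ord0 i ^+ 2).

Definition bounded_domain Om : Prop :=
  [/\ open Om, connected Om, Om !=set0 & bounded_set Om].

Definition dist_to x A : R := inf [set eucl_norm (x - y) | y in A].

Definition nl_boundary (delta : R) Om : set 'rV[R]_d :=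
  [set x | ~ Om x /\ dist_to x Om <= delta].

Definition nl_closure (delta : R) Om : set 'rV[R]_d :=
  Om `|` nl_boundary delta Om.

Definition kernel (delta : R) z : R := if eucl_norm z <= delta then 1 else 0.

(* Elements of L_2 are represented by Borel functions on R^d of which only the
   restriction to the nonlocal closure matters; equalities hold a.e. *)
Definition L20 (delta : R) Om u : Prop :=
  let S := nl_closure delta Om in
  [/\ measurable_fun S u,
      mu.-integrable S (fun x => (u x ^+ 2)%:E) &
      {ae mu, forall x, nl_boundary delta Om x -> u x = 0}].

Definition L2_null (delta : R) Om u : Prop :=
  {ae mu, forall x, nl_closure delta Om x -> u x = 0}.

Definition L2_normsq (delta : R) Om u : R :=
  \int[mu]_(x in nl_closure delta Om) u x ^+ 2.

Definition nl_form (delta : R) Om u v : R :=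
  2^-1 * \int[mu]_(x in nl_closure delta Om)
           \int[mu]_(x' in nl_closure delta Om)
             (kernel delta (x - x') * (u x' - u x) * (v x' - v x)).

End nonlocal_form.

Section cube_mesh.
Context {R : realType} {d : nat}.

(* A d-cube of side h is the image of the unit cube under
   t |-> corner + h * (t *m frame): the rows of the orthogonal matrix frame are
   the directions of its edges at the vertex corner. *)
Record cube := Cube {
  corner : 'rV[R]_d;
  frame : 'M[R]_d;
  frame_orthogonal : frame *m frame^T = 1%:M }.

Definition cube_point (h : R) (Q : cube) (t : 'rV[R]_d) : 'rV[R]_d :=
  corner Q + h *: (t *m frame Q).

Definition closed_cube (h : R) (Q : cube) : set 'rV[R]_d :=
  [set cube_point h Q t | t in [set t : 'rV[R]_d | forall i, 0 <= t ord0 i <= 1]].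

Definition open_cube (h : R) (Q : cube) : set 'rV[R]_d :=
  [set cube_point h Q t | t in [set t : 'rV[R]_d | forall i, 0 < t ord0 i < 1]].

(* f i = Some b fixes the i-th local coordinate to b; the face is the whole
   cube when f is None everywhere, and a vertex when it is None nowhere. *)
Definition face (h : R) (Q : cube) (f : 'I_d -> option bool) : set 'rV[R]_d :=
  [set cube_point h Q t | t in [set t : 'rV[R]_d | forall i,
     if f i is Some b then t ord0 i = b%:R else 0 <= t ord0 i <= 1]].

Definition vertex (h : R) (Q : cube) : set 'rV[R]_d :=
  [set cube_point h Q (\row_i (b i)%:R) | b in [set: 'I_d -> bool]].

(* Two distinct elements are disjoint or meet along a proper face of both. *)
Definition conforming_mesh (h : R) (N : nat) (T : 'I_N -> cube) : Prop :=
  forall k l, k != l ->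
    let I := closed_cube h (T k) `&` closed_cube h (T l) in
    I = set0 \/
    exists f g, [/\ exists i, f i <> None, exists i, g i <> None,
                    I = face h (T k) f & I = face h (T l) g].

Definition node (h : R) (N : nat) (T : 'I_N -> cube) : set 'rV[R]_d :=
  \bigcup_k vertex h (T k).

End cube_mesh.
Arguments cube : clear implicits.

(* On cubes, piecewise linear elements are the continuous piecewise multilinear
   ones, with the vertices as nodes. *)
Inductive fe_kind := PiecewiseConstant | PiecewiseLinear.

Section finite_elements.
Context {R : realType} {d : nat}.
Variables (h : R) (N : nat) (T : 'I_N -> cube R d).
Implicit Types (v : 'rV[R]_d -> R).

(* Functions are extended by 0 off the mesh. Piecewise constants are taken to
   be 0 on the interfaces, a null set. A piecewise linear function takes a
   single value on each interface, hence is continuous on the mesh. *)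
Definition fe_space (kind : fe_kind) v : Prop :=
  match kind with
  | PiecewiseConstant =>
      (forall k, exists c, forall x, open_cube h (T k) x -> v x = c) /\
      (forall x, (forall k, ~ open_cube h (T k) x) -> v x = 0)
  | PiecewiseLinear =>
      (forall k, exists a : {set 'I_d} -> R,
         forall t : 'rV[R]_d, (forall i, 0 <= t ord0 i <= 1) ->
         v (cube_point h (T k) t) =
           \sum_(J : {set 'I_d}) a J * \prod_(i in J) t ord0 i) /\
      (forall x, (forall k, ~ closed_cube h (T k) x) -> v x = 0)
  end.

Definition shape_function (kind : fe_kind) v : Prop :=
  fe_space kind v /\
  match kind with
  | PiecewiseConstant =>
      exists k, forall l x, open_cube h (T l) x -> v x = (l == k)%:R
  | PiecewiseLinear =>
      exists2 p, node h T p & forall q, node h T q -> v q = (q == p)%:R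
  end.

(* The functions are on the nonlocal closure, extended by 0 outside it: the
   mesh may stick out of the nonlocal closure. *)
Definition fe_space0 (delta : R) (Om : set 'rV[R]_d) (kind : fe_kind) v : Prop :=
  [/\ fe_space kind v, L20 delta Om v &
      {ae lebesgue_rV d, forall x, ~ nl_closure delta Om x -> v x = 0}].

(* phi enumerates the shape functions lying in fe_space0, without repetition. *)
Definition standard_basis (delta : R) (Om : set 'rV[R]_d) (kind : fe_kind)
    (n : nat) (phi : 'I_n -> 'rV[R]_d -> R) : Prop :=
  set_bij [set: 'I_n]
    [set v | shape_function kind v /\ fe_space0 delta Om kind v] phi.

End finite_elements.

Section stiffness.
Context {R : realType}.

Definition stiffness {d : nat} (delta : R) (Om : set 'rV[R]_d) (n : nat)
    (phi : 'I_n -> 'rV[R]_d -> R) : 'M[R]_n :=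
  \matrix_(i, j) nl_form delta Om (phi j) (phi i).

Definition sym_posdef {n : nat} (K : 'M[R]_n) : Prop :=
  K^T = K /\
  forall x : 'rV[R]_n, x != 0 -> 0 < (x *m K *m x^T) ord0 ord0.

(* For K symmetric positive definite, the set of eigenvalues is finite, so sup
   and inf are its maximum and minimum. *)
Definition cond_number {n : nat} (K : 'M[R]_n) : R :=
  sup [set a | eigenvalue K a] / inf [set a | eigenvalue K a].

End stiffness.

(* Main.v *)
(* Write w for u restricted to Om and extended by 0. Any pair of points at
   distance at most delta on which w differs lies in the nonlocal closure, so
   the form is half the integral of chi(x - x') (w(x') - w(x))^2 over all pairs
   of points.

   Upper bound: (a - b)^2 <= 2 a^2 + 2 b^2, Tonelli, and a ball of radius delta
   lies in a cube of side 2 delta.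

   Lower bound: let D(z) be the integral of (w(x + z) - w(x))^2 in x, so that
   the form is half the integral of D over the delta-ball. By translation
   invariance D(m z) <= m^2 D(z). If z is in the cube [delta/2d, delta/d]^d and
   m is of order 1/delta, then m z moves Om off itself, so D(m z) >= |w|^2 and
   hence D(z) >= c delta^2 |w|^2; integrate over this cube, of measure
   (delta/2d)^d.

   Stiffness matrix: it remains to compare |u|^2 with h^d times the sum of the
   squares of the coefficients of u, up to constants that depend only on d.
   Rotated cubes need no change of variables: only translations by half-edges
   and axis-parallel boxes inside and around each element are used. *)
Require Import Defs.
From mathcomp Require Import all_boot all_order all_algebra.
From mathcomp Require Import all_classical all_reals all_analysis.
From mathcomp Require Import measurable_realfun ring lra.

Import Order.TTheory GRing.Theory Num.Theory.
Import numFieldNormedType.Exports.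

Local Open Scope classical_set_scope.
Local Open Scope ring_scope.

Set Implicit Arguments.
Unset Strict Implicit.
Unset Printing Implicit Defensive.

(* MathComp-Analysis exports another kernel, which shadows the one of Defs. *)
Local Notation kernel := Defs.kernel.

(** * Lebesgue measure on row vectors *)

Section translation_invariance.
Context {R : realType}.
Local Open Scope ereal_scope.

(** Both measures give the same length to half-open intervals, and Lebesgue measure is the only one
    that does. *)
Lemma lebesgue_measure_shift (a : R) (A : set R) : measurable A ->
  pushforward (@lebesgue_measure R) ((fun x => x + a)%R : _ -> measurableTypeR R) A
  = lebesgue_measure A.
Proof.
have ma : measurable_fun [set: measurableTypeR R]
    ((fun x => x + a)%R : measurableTypeR R -> measurableTypeR R).
  exact: measurable_funD.
move=> mA.
pose nu := @measure_function_pushforward__canonical__measure_function_Measure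
   _ _ _ _ R (@lebesgue_measure R) _ ma.
apply/esym/(@lebesgue_measure_unique _ nu) => // _ [[u v]] _ <-.
rewrite /nu/= /pushforward.
have -> : (fun x => x + a)%R @^-1` `]u, v]%classic = `](u - a)%R, (v - a)%R]%classic.
  by apply/seteqP; split => x /=; rewrite !in_itv/= => /andP[? ?]; apply/andP; split; lra.
rewrite !lebesgue_measure_itv/= !lte_fin ltrD2r; case: ifP => // _.
by rewrite -!EFinB; congr EFin; lra.
Qed.

Lemma ge0_integral_shift (a : R) (f : R -> \bar R) :
  measurable_fun setT f -> (forall x, 0 <= f x) ->
  \int[lebesgue_measure]_x f (x + a)%R = \int[lebesgue_measure]_x f x.
Proof.
move=> mf f0.
have ma : measurable_fun [set: measurableTypeR R]
    ((fun x => x + a)%R : measurableTypeR R -> measurableTypeR R).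
  exact: measurable_funD.
rewrite (_ : (fun x => f _) = f \o (fun x => x + a)%R)//.
rewrite -(preimage_setT (fun x : R => x + a)%R).
rewrite -(ge0_integral_pushforward ma)//.
by apply: eq_measure_integral => A mA _; exact: lebesgue_measure_shift.
Qed.

(** By construction the measure is the image of a product measure under [cons_rV], so Tonelli splits
    off the first coordinate. This is what makes induction on the dimension possible. *)
Lemma ge0_integral_lebesgue_rVS n (f : 'rV[R]_n.+1 -> \bar R) :
  measurable_fun setT f -> (forall x, 0 <= f x) ->
  \int[lebesgue_rV n.+1]_x f x =
  \int[lebesgue_measure]_a \int[lebesgue_rV n]_x f (cons_rV (a, x)).
Proof.
move=> mf f0.
transitivity (\int[pushforward (@lebesgue_measure R \x lebesgue_rV n)
  (@cons_rV R n)]_x f x) => //.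
transitivity (\int[(@lebesgue_measure R \x lebesgue_rV n)]_x (f \o @cons_rV R n) x).
  rewrite -[in RHS](preimage_setT (@cons_rV R n)).
  by rewrite -(@ge0_integral_pushforward _ _ (measurableTypeR R * 'rV[R]_n)%type
    _ _ _ (@measurable_cons_rV R n)).
rewrite (@fubini_tonelli1 _ _ (measurableTypeR R) _ _ _ _ (f \o @cons_rV R n))//=.
by apply: measurableT_comp => //; exact: measurable_cons_rV.
Qed.

Lemma measurable_rV_shift n (z : 'rV[R]_n) : measurable_fun setT (fun x : 'rV[R]_n => x + z)%R.
Proof.
apply: measurable_fun_rV => i.
rewrite (_ : _ \o _ = (fun x => rV_coord i x + z ord0 i)%R).
  by apply: measurable_funD => //; exact: measurable_rV_coord.
by apply/funext => x; rewrite /= /rV_coord mxE.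
Qed.

Lemma cons_rV_ord0 n (p : R * 'rV[R]_n) : cons_rV p ord0 ord0 = p.1.
Proof.
have -> : ord0 = lshift n ord0 :> 'I_(1 + n) by exact/val_inj.
by rewrite /cons_rV (@row_mxEl _ 1 1 n) mxE eqxx mulr1n.
Qed.

Lemma cons_rV_lift n (p : R * 'rV[R]_n) i :
  cons_rV p ord0 (lift ord0 i) = p.2 ord0 i.
Proof.
have -> : lift ord0 i = rshift 1 i :> 'I_(1 + n) by exact/val_inj.
by rewrite /cons_rV (@row_mxEr _ 1 1 n).
Qed.

Lemma rVS_eq n (x y : 'rV[R]_n.+1) : x ord0 ord0 = y ord0 ord0 ->
  (forall i, x ord0 (lift ord0 i) = y ord0 (lift ord0 i)) -> x = y.
Proof. by move=> h0 hS; apply/rowP => i; case: (unliftP ord0 i) => [j|] ->. Qed.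

Lemma uncons_rVK n : cancel (@uncons_rV R n) (@cons_rV R n).
Proof.
move=> x; apply: rVS_eq => [|i]; rewrite ?cons_rV_ord0// cons_rV_lift/= mxE.
by congr (x _ _); exact: val_inj.
Qed.

Lemma uncons_rV_lift n (x : 'rV[R]_n.+1) i :
  (uncons_rV x).2 ord0 i = x ord0 (lift ord0 i).
Proof. by rewrite -[in RHS](uncons_rVK x) cons_rV_lift. Qed.

Lemma cons_rVD n (a b : R) (x y : 'rV[R]_n) :
  (cons_rV (a, x) + cons_rV (b, y) = cons_rV (a + b, x + y))%R.
Proof.
by apply: rVS_eq => [|i]; rewrite mxE !(cons_rV_ord0, cons_rV_lift)//= mxE.
Qed.
End translation_invariance.

Section translation_invariance_rV.
Context {R : realType}.
Local Open Scope ereal_scope.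

(** Induction on the dimension: the first coordinate is translated by the one-dimensional case, the
    remaining ones by the induction hypothesis. In dimension 0 there is only one point. *)
Lemma ge0_integral_rV_shift n (z : 'rV[R]_n) (f : 'rV[R]_n -> \bar R) :
  measurable_fun setT f -> (forall x, 0 <= f x) ->
  \int[lebesgue_rV n]_x f (x + z)%R = \int[lebesgue_rV n]_x f x.
Proof.
elim: n z f => [z f mf f0|n IH z f mf f0].
  by apply: eq_integral => x _; congr f; rewrite !(flatmx0, thinmx0).
rewrite !ge0_integral_lebesgue_rVS//; last first.
  by apply: measurableT_comp => //; exact: measurable_rV_shift.
rewrite -(uncons_rVK z); case: (uncons_rV z) => a w.
have mfc : measurable_fun setT (f \o @cons_rV R n).
  by apply: measurableT_comp => //; exact: measurable_cons_rV.
rewrite -[RHS](ge0_integral_shift a); last 2 first.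
- exact: (@measurable_fun_fubini_tonelli_F _ _ (measurableTypeR R) _ _ _
    (f \o @cons_rV R n) mfc (fun=> f0 _)).
- by move=> x; exact: integral_ge0.
apply: eq_integral => b _; under eq_integral do rewrite cons_rVD.
rewrite (IH w (fun x => f (cons_rV (b + a, x)%R)))//.
exact: (@measurable_fun_pair2 _ _ _ (measurableTypeR R) _ _ (f \o @cons_rV R n)).
Qed.

Definition rV_box n (l u : 'rV[R]_n) : set 'rV[R]_n :=
  [set x | forall i, (l ord0 i <= x ord0 i <= u ord0 i)%R].

Lemma measurable_rV_box n (l u : 'rV[R]_n) : measurable (rV_box l u).
Proof.
rewrite (_ : rV_box l u = \bigcap_(i in [set: 'I_n])
   (@rV_coord R n i @^-1` `[l ord0 i, u ord0 i]%classic)); last first.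
  by apply/seteqP; split => [x h i _|x h i]; have := h i; rewrite /= in_itv/=; apply.
apply: fin_bigcap_measurable => // i _; rewrite -[X in measurable X]setTI.
exact: measurable_rV_coord.
Qed.

Lemma lebesgue_rV_box n (l u : 'rV[R]_n) : (forall i, l ord0 i <= u ord0 i)%R ->
  lebesgue_rV n (rV_box l u) = (\prod_i (u ord0 i - l ord0 i))%:E.
Proof.
elim: n l u => [l u _|n IH l u lu].
  rewrite big_ord0 /= diracE mem_set// => -[].
  by [].
rewrite [LHS](_ : _ =
  (@lebesgue_measure R \x lebesgue_rV n) (@cons_rV R n @^-1` rV_box l u))//.
rewrite (_ : _ @^-1` _ = `[l ord0 ord0, u ord0 ord0]%classic `*`
  rV_box (uncons_rV l).2 (uncons_rV u).2); last first.
  apply/seteqP; split => [[a x] h/=|[a x] [/= h0 hS] i].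
    split => [|i]; last by have := h (lift ord0 i); rewrite cons_rV_lift/= !uncons_rV_lift.
    by have := h ord0; rewrite cons_rV_ord0 in_itv.
  case: (unliftP ord0 i) => [j|] ->; last by rewrite cons_rV_ord0; rewrite in_itv in h0.
  by have := hS j; rewrite !uncons_rV_lift cons_rV_lift.
rewrite (@product_measure1E _ _ (measurableTypeR R))//; last exact: measurable_rV_box.
rewrite big_ord_recl EFinM; congr (_ * _).
  rewrite [LHS](lebesgue_measure_itv `[l ord0 ord0, u ord0 ord0])/= lte_fin -EFinB.
  case: ltP => //.
  by move=> ul; congr EFin; apply/esym/eqP; rewrite subr_eq0 eq_le ul lu.
rewrite IH => [|i]; last by rewrite !uncons_rV_lift.
by congr EFin; apply: eq_bigr => i _; rewrite !uncons_rV_lift.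
Qed.
End translation_invariance_rV.

(** * The kernel *)

Section eucl_norm.
Context {R : realType} {d : nat}.
Implicit Types x y z : 'rV[R]_d.

Lemma coord_le_eucl_norm x i : `|x ord0 i| <= eucl_norm x.
Proof.
rewrite -sqrtr_sqr ler_wsqrtr// (bigD1 i)//= lerDl.
by apply: sumr_ge0 => j _; exact: sqr_ge0.
Qed.

(** The factor [d] is used instead of its square root: it needs only [d <= d ^ 2], and constants
    depending on [d] do not matter. *)
Lemma eucl_norm_le_coord x (r : R) : 0 <= r ->
  (forall i, `|x ord0 i| <= r) -> eucl_norm x <= d%:R * r.
Proof.
move=> r0 xr; have dr0 : 0 <= d%:R * r by rewrite mulr_ge0.
rewrite -[leRHS]ger0_norm// -sqrtr_sqr ler_wsqrtr//.
apply: (@le_trans _ _ (\sum_(i < d) r ^+ 2)).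
  by apply: ler_sum => i _; rewrite -real_normK ?num_real// lerXn2r ?nnegrE.
rewrite sumr_const card_ord exprMn -[r ^+ 2 *+ _]mulr_natl ler_wpM2r ?sqr_ge0//.
by rewrite -natrX ler_nat; case: d => // n; rewrite leq_pmulr.
Qed.

Lemma eucl_normN x : eucl_norm (- x) = eucl_norm x.
Proof. by congr Num.sqrt; apply: eq_bigr => i _; rewrite mxE sqrrN. Qed.

Lemma kernelN (delta : R) z : kernel delta (- z) = kernel delta z.
Proof. by rewrite /kernel eucl_normN. Qed.

Lemma kernel_ge0 (delta : R) z : 0 <= kernel delta z.
Proof. by rewrite /kernel; case: ifP. Qed.

Lemma kernel_le_box (delta : R) x y :
  kernel delta (x - y) <= \1_(rV_box (x - const_mx delta) (x + const_mx delta)) y.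
Proof.
rewrite /kernel indicE; case: ifPn => // xy; rewrite mem_set//= => i.
have /le_trans/(_ xy) := coord_le_eucl_norm (x - y) i.
by rewrite !mxE ler_norml => /andP[? ?]; apply/andP; split; lra.
Qed.

Lemma measurable_eucl_norm_le (delta : R) :
  measurable [set z : 'rV[R]_d | eucl_norm z <= delta].
Proof.
have mS : measurable_fun setT (fun z : 'rV[R]_d => \sum_i z ord0 i ^+ 2).
  apply: measurable_sum => i; apply: measurable_funX.
  exact: measurable_rV_coord.
(* The ball is empty for negative [delta]; otherwise both sides can be squared, which leaves a
   polynomial condition. *)
have [d0|d0] := ltP delta 0.
  rewrite (_ : [set _ | _] = set0)//; apply/seteqP; split => // z /= zd.
  by have := le_lt_trans zd d0; rewrite ltNge sqrtr_ge0.
rewrite (_ : [set _ | _] =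
    (fun z : 'rV[R]_d => \sum_i z ord0 i ^+ 2) @^-1` `]-oo, delta ^+ 2]%classic).
  by rewrite -[X in measurable X]setTI; exact: mS.
apply/seteqP; split => z /=; rewrite in_itv/= /eucl_norm => h.
  by rewrite -ler_sqrt ?sqrtr_sqr ?ger0_norm ?sqr_ge0.
by rewrite -(ger0_norm d0) -sqrtr_sqr ler_wsqrtr.
Qed.

Lemma measurable_rVB : measurable_fun setT
  (fun p : 'rV[R]_d * 'rV[R]_d => p.1 - p.2).
Proof.
apply: measurable_fun_rV => i.
rewrite (_ : _ \o _ = (fun p => rV_coord i p.1 - rV_coord i p.2)); last first.
  by apply/funext => p; rewrite /rV_coord/= !mxE.
apply: measurable_funB.
  exact: (measurableT_comp (measurable_rV_coord i) measurable_fst).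
exact: (measurableT_comp (measurable_rV_coord i) measurable_snd).
Qed.

Lemma measurable_rVD : measurable_fun setT
  (fun p : 'rV[R]_d * 'rV[R]_d => p.1 + p.2).
Proof.
apply: measurable_fun_rV => i.
rewrite (_ : _ \o _ = (fun p => rV_coord i p.1 + rV_coord i p.2)); last first.
  by apply/funext => p; rewrite /rV_coord/= !mxE.
apply: measurable_funD.
  exact: (measurableT_comp (measurable_rV_coord i) measurable_fst).
exact: (measurableT_comp (measurable_rV_coord i) measurable_snd).
Qed.

Lemma measurable_nl_kernel (delta : R) :
  measurable_fun setT (kernel delta : 'rV[R]_d -> R).
Proof.
rewrite (_ : kernel delta = \1_[set z : 'rV[R]_d | eucl_norm z <= delta]).
  by apply/measurable_indicP; exact: measurable_eucl_norm_le.
apply/funext => z; rewrite /kernel indicE; case: ifPn => h.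
  by rewrite mem_set.
by rewrite memNset//; exact/negP.
Qed.

Lemma measurable_nl_kernel2 (delta : R) : measurable_fun setT
  (fun p : 'rV[R]_d * 'rV[R]_d => kernel delta (p.1 - p.2)).
Proof. exact: (measurableT_comp (measurable_nl_kernel delta) measurable_rVB). Qed.

End eucl_norm.

(** * Schur-type bounds for the kernel *)

Section schur.
Context {R : realType} {d : nat}.
Local Notation mu := (@lebesgue_rV R d).
Local Notation V := 'rV[R]_d.
Local Open Scope ereal_scope.

(** The ball around [x] lies in a cube of side [2 * delta]. *)
Lemma integral_kernel_le (delta : R) (x : V) : (0 <= delta)%R ->
  \int[mu]_y (kernel delta (x - y))%:E <= ((2 * delta) ^+ d)%:E.
Proof.
move=> d0; set l := (x - const_mx delta)%R; set u := (x + const_mx delta)%R.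
have mB : measurable (rV_box l u) by exact: measurable_rV_box.
apply: (@le_trans _ _ (\int[mu]_y (\1_(rV_box l u) y)%:E)).
  apply: ge0_le_integral => //.
  - by move=> y _; rewrite lee_fin kernel_ge0.
  - apply/measurable_EFinP.
    exact: (@measurable_fun_pair2 _ _ _ _ _ _ _ x (measurable_nl_kernel2 delta)).
  - by apply/measurable_EFinP; exact/measurable_indicP.
  - by move=> y _; rewrite lee_fin kernel_le_box.
rewrite integral_indic// setIT [leLHS]lebesgue_rV_box => [|i].
  rewrite lee_fin (eq_bigr (fun=> 2 * delta)%R); last by move=> i _; rewrite !mxE; ring.
  by rewrite prodr_const card_ord.
by rewrite !mxE; lra.
Qed.

Variables (delta : R) (g : V -> R).
Hypotheses (d0 : (0 <= delta)%R) (mg : measurable_fun setT g)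
  (g0 : forall x, (0 <= g x)%R).

Let mk1 : measurable_fun setT
  (fun p : V * V => (kernel delta (p.1 - p.2) * g p.1)%:E).
Proof.
apply/measurable_EFinP; apply: measurable_funM; first exact: measurable_nl_kernel2.
exact: (measurableT_comp mg measurable_fst).
Qed.

Let mk2 : measurable_fun setT
  (fun p : V * V => (kernel delta (p.1 - p.2) * g p.2)%:E).
Proof.
apply/measurable_EFinP; apply: measurable_funM; first exact: measurable_nl_kernel2.
exact: (measurableT_comp mg measurable_snd).
Qed.

Let step x : \int[mu]_y (kernel delta (x - y) * g x)%:E <=
  ((2 * delta) ^+ d)%:E * (g x)%:E.
Proof.
under eq_integral do rewrite EFinM.
rewrite ge0_integralZr//; first by rewrite lee_wpmul2r ?lee_fin// integral_kernel_le.
- apply/measurable_EFinP.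
  exact: (@measurable_fun_pair2 _ _ _ _ _ _ _ x (measurable_nl_kernel2 delta)).
- by move=> y _; rewrite lee_fin kernel_ge0.
- by rewrite lee_fin.
Qed.

(** Tonelli with the second variable integrated first: [g p.1] is then constant, and the kernel has
    mass at most [(2 * delta) ^+ d]. *)
Lemma integral_kernel1_le :
  \int[mu \x mu]_p (kernel delta (p.1 - p.2) * g p.1)%:E <=
  ((2 * delta) ^+ d)%:E * \int[mu]_x (g x)%:E.
Proof.
rewrite fubini_tonelli1//; last first.
  by move=> p; rewrite lee_fin mulr_ge0 ?kernel_ge0.
rewrite -ge0_integralZl//; last 3 first.
- exact/measurable_EFinP.
- by move=> x _; rewrite lee_fin.
- by rewrite lee_fin exprn_ge0// mulr_ge0.
apply: ge0_le_integral => //.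
- by move=> x _; apply: integral_ge0 => y _; rewrite lee_fin mulr_ge0 ?kernel_ge0.
- apply: measurable_fun_fubini_tonelli_F => // p.
  by rewrite lee_fin mulr_ge0 ?kernel_ge0.
- by apply: measurable_funeM; exact/measurable_EFinP.
- by move=> x _; exact: step.
Qed.

(** The same in the other order of integration, the kernel being even. *)
Lemma integral_kernel2_le :
  \int[mu \x mu]_p (kernel delta (p.1 - p.2) * g p.2)%:E <=
  ((2 * delta) ^+ d)%:E * \int[mu]_x (g x)%:E.
Proof.
rewrite fubini_tonelli2//; last first.
  by move=> p; rewrite lee_fin mulr_ge0 ?kernel_ge0.
rewrite -ge0_integralZl//; last 3 first.
- exact/measurable_EFinP.
- by move=> x _; rewrite lee_fin.
- by rewrite lee_fin exprn_ge0// mulr_ge0.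
apply: ge0_le_integral => //.
- by move=> x _; apply: integral_ge0 => y _; rewrite lee_fin mulr_ge0 ?kernel_ge0.
- apply: measurable_fun_fubini_tonelli_G => // p.
  by rewrite lee_fin mulr_ge0 ?kernel_ge0.
- by apply: measurable_funeM; exact/measurable_EFinP.
- move=> y _; rewrite /fubini_G/=; apply: le_trans (step y).
  by under eq_integral do rewrite -kernelN opprB.
Qed.

End schur.

(** * The nonlocal form on square-integrable functions *)

Section ge0_integrable.
Context d (T : measurableType d) (R : realType) (m : {measure set T -> \bar R}).
Implicit Type f : T -> R.

Lemma ge0_integrable f : measurable_fun setT f -> (forall x, 0 <= f x) ->
  (\int[m]_x (f x)%:E < +oo)%E -> m.-integrable setT (EFin \o f).
Proof.
move=> mf f0 foo; apply/integrableP; split; first exact/measurable_EFinP.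
by under eq_integral do rewrite gee0_abs ?lee_fin//.
Qed.

Lemma ge0_integrable_lty f : (forall x, 0 <= f x) ->
  m.-integrable setT (EFin \o f) -> (\int[m]_x (f x)%:E < +oo)%E.
Proof.
move=> f0 /integrableP[mf]; under eq_integral do rewrite gee0_abs ?lee_fin//.
by [].
Qed.

End ge0_integrable.

Section sqr_integrable.
Context {R : realType} {d : nat}.
Local Notation mu := (@lebesgue_rV R d).
Local Notation mu2 := (mu \x mu)%E.
Local Notation V := 'rV[R]_d.
Implicit Types u v w : V -> R.

(** Square integrability on the whole space: it is applied to functions cut off to a set and
    extended by 0, so that translations are available. *)
Definition sqr_integrable u := measurable_fun setT u /\
  mu.-integrable setT (fun x => (u x ^+ 2)%:E).

(** A function of pairs over the whole space, to be integrated against the product measure;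
    [nl_formE] relates it to the iterated integrals of [nl_form]. *)
Definition nl_integrand (delta : R) u v (p : V * V) : R :=
  kernel delta (p.1 - p.2) * (u p.2 - u p.1) * (v p.2 - v p.1).

Lemma measurable_nl_integrand (delta : R) u v :
  measurable_fun setT u -> measurable_fun setT v ->
  measurable_fun setT (nl_integrand delta u v).
Proof.
move=> mu_ mv; apply: measurable_funM; first apply: measurable_funM.
- exact: measurable_nl_kernel2.
- apply: measurable_funB.
    exact: (measurableT_comp mu_ measurable_snd).
  exact: (measurableT_comp mu_ measurable_fst).
- apply: measurable_funB.
    exact: (measurableT_comp mv measurable_snd).
  exact: (measurableT_comp mv measurable_fst).
Qed.

Section kernel_sqr.
Variables (delta : R) (u : V -> R).
Hypotheses (d0 : 0 <= delta) (hu : sqr_integrable u).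

Let msqr : measurable_fun setT (fun x => u x ^+ 2).
Proof. by apply: measurable_funX; case: hu. Qed.

Let u2_lty : (\int[mu]_x (u x ^+ 2)%:E < +oo)%E.
Proof. by apply: ge0_integrable_lty => [x|]; [exact: sqr_ge0|case: hu]. Qed.

Let kd_lty : (((2 * delta) ^+ d)%:E * \int[mu]_x (u x ^+ 2)%:E < +oo)%E.
Proof. by rewrite lte_mul_pinfty// lee_fin exprn_ge0// mulr_ge0. Qed.

Lemma integrable_kernel_sqr1 : mu2.-integrable setT
  (fun p => (kernel delta (p.1 - p.2) * u p.1 ^+ 2)%:E).
Proof.
apply: ge0_integrable => [|p|].
- apply: measurable_funM; first exact: measurable_nl_kernel2.
  exact: (measurableT_comp msqr measurable_fst).
- by rewrite mulr_ge0 ?kernel_ge0 ?sqr_ge0.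
- apply: le_lt_trans kd_lty.
  by apply: (integral_kernel1_le d0 msqr) => x; exact: sqr_ge0.
Qed.

Lemma integrable_kernel_sqr2 : mu2.-integrable setT
  (fun p => (kernel delta (p.1 - p.2) * u p.2 ^+ 2)%:E).
Proof.
apply: ge0_integrable => [|p|].
- apply: measurable_funM; first exact: measurable_nl_kernel2.
  exact: (measurableT_comp msqr measurable_snd).
- by rewrite mulr_ge0 ?kernel_ge0 ?sqr_ge0.
- apply: le_lt_trans kd_lty.
  by apply: (integral_kernel2_le d0 msqr) => x; exact: sqr_ge0.
Qed.

End kernel_sqr.

(** Domination: [|(b - a) * (e - c)|] is at most [a^2 + b^2 + c^2 + e^2], and the kernel times each
    square is integrable. *)
Lemma integrable_nl_integrand (delta : R) u v : 0 <= delta ->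
  sqr_integrable u -> sqr_integrable v ->
  mu2.-integrable setT (EFin \o nl_integrand delta u v).
Proof.
move=> d0 hu hv.
have iu := integrableD measurableT (integrable_kernel_sqr1 d0 hu)
  (integrable_kernel_sqr2 d0 hu).
have iv := integrableD measurableT (integrable_kernel_sqr1 d0 hv)
  (integrable_kernel_sqr2 d0 hv).
apply: le_integrable (integrableD measurableT iu iv) => //.
  apply/measurable_EFinP; apply: measurable_nl_integrand.
    by case: hu.
  by case: hv.
move=> p _; rewrite -!EFinD !abse_EFin lee_fin.
rewrite [leRHS]ger0_norm; last first.
  by rewrite !addr_ge0// mulr_ge0// ?kernel_ge0// sqr_ge0.
rewrite -!mulrDr /nl_integrand -mulrA normrM ger0_norm ?kernel_ge0//.
rewrite ler_wpM2l ?kernel_ge0//.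
move: (u p.1) (u p.2) (v p.1) (v p.2) => a b c e.
(* The last two squares bound the product by half of [(b - a)^2 + (e - c)^2], the first two bound
   these by sums of squares. *)
have s1 := sqr_ge0 (a + b); have s2 := sqr_ge0 (c + e).
have s3 := sqr_ge0 (b - a + (e - c)); have s4 := sqr_ge0 (b - a - (e - c)).
by rewrite ler_norml; apply/andP; split; nra.
Qed.

(** The leading 2 is [1/2 * 2 * 2]: the half in the form, the factor in
    [(b - a)^2 <= 2 * (a^2 + b^2)], and the two squares, which contribute equally. *)
Lemma nl_integrand_le (delta : R) u : 0 <= delta -> sqr_integrable u ->
  2^-1 * \int[mu2]_p nl_integrand delta u u p <=
  (2 * (2 * delta) ^+ d) * \int[mu]_x (u x ^+ 2).
Proof.
move=> d0 hu.
have msqr : measurable_fun setT (fun x => u x ^+ 2).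
  by apply: measurable_funX; case: hu.
have i1 := integrable_kernel_sqr1 d0 hu.
have i2 := integrable_kernel_sqr2 d0 hu.
have i12 := integrableD measurableT i1 i2.
have b1 : \int[mu2]_p (kernel delta (p.1 - p.2) * u p.1 ^+ 2) <=
    (2 * delta) ^+ d * \int[mu]_x (u x ^+ 2).
  rewrite -lee_fin EFinM !fineK; last 2 first.
  - by apply: integrable_fin_num => //; case: hu.
  - exact: integrable_fin_num.
  by apply: (integral_kernel1_le d0 msqr) => x; exact: sqr_ge0.
have b2 : \int[mu2]_p (kernel delta (p.1 - p.2) * u p.2 ^+ 2) <=
    (2 * delta) ^+ d * \int[mu]_x (u x ^+ 2).
  rewrite -lee_fin EFinM !fineK; last 2 first.
  - by apply: integrable_fin_num => //; case: hu.
  - exact: integrable_fin_num.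
  by apply: (integral_kernel2_le d0 msqr) => x; exact: sqr_ge0.
apply: (@le_trans _ _ (2^-1 * (2 * (\int[mu2]_p
  (kernel delta (p.1 - p.2) * u p.1 ^+ 2 + kernel delta (p.1 - p.2) * u p.2 ^+ 2))))).
  rewrite ler_wpM2l// -RintegralZl//; apply: le_Rintegral => //.
  - exact: integrable_nl_integrand.
  - exact: (integrableZl measurableT 2 i12).
  move=> p _; rewrite /nl_integrand -mulrDr -mulrA [leRHS]mulrCA ler_wpM2l ?kernel_ge0//.
  have := sqr_ge0 (u p.1 + u p.2); nra.
have aux (a b c : R) : a <= c -> b <= c -> 2^-1 * (2 * (a + b)) <= 2 * c by lra.
by rewrite RintegralD// -[leRHS]mulrA; exact: aux.
Qed.

End sqr_integrable.

(** * The nonlocal Poincare inequality *)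

Section poincare.
Context {R : realType} {d : nat}.
Local Notation mu := (@lebesgue_rV R d).
Local Notation mu2 := (mu \x mu)%E.
Local Notation V := 'rV[R]_d.
Variable u : V -> R.
Hypothesis mu_ : measurable_fun setT u.

(** The D(z) of the overview, in the extended reals so that it makes sense for every measurable
    [u]. *)
Definition shift_dist (z : V) : \bar R :=
  (\int[mu]_x ((u (x + z)%R - u x)%R ^+ 2)%:E)%E.

Let msh z : measurable_fun setT (fun x : V => (u (x + z) - u x) ^+ 2).
Proof.
apply: measurable_funX; apply: measurable_funB => //.
exact: (measurableT_comp mu_ (measurable_rV_shift z)).
Qed.

(** This is the squared triangle inequality in L_2 for [n] successive translations; the weighted
    induction avoids square roots and any finiteness question. *)
Lemma shift_distMn (z : V) n :
  (shift_dist (z *+ n) <= (n%:R ^+ 2)%:E * shift_dist z)%E.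
Proof.
have D0 : (0 <= shift_dist z)%E by apply: integral_ge0 => x _; rewrite lee_fin sqr_ge0.
case: n => [|n].
  rewrite expr0n mul0e /shift_dist (eq_integral (cst 0%E)) ?integral0// => x _.
  by rewrite mulr0n addr0 subrr expr0n.
(* With a the increment over z *+ n.+1 and b the one over z,
   (a + b)^2 <= (1 + 1/(n+1)) a^2 + (n+2) b^2. *)
elim: n => [|n IH]; first by rewrite mulr1n expr1n mul1e.
have n0 : (0 : R) < n.+1%:R by [].
apply: (@le_trans _ _ ((1 + n.+1%:R^-1)%:E * shift_dist (z *+ n.+1) +
    (1 + n.+1%:R)%:E * shift_dist z)%E); last first.
  apply: (@le_trans _ _ ((1 + n.+1%:R^-1)%:E * ((n.+1%:R ^+ 2)%:E * shift_dist z) +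
    (1 + n.+1%:R)%:E * shift_dist z)%E).
    by rewrite leeD2r// lee_wpmul2l// lee_fin addr_ge0.
  (* The weights are tuned so that [(1 + 1/t) * t^2 + (1 + t) = (t + 1)^2] with [t = n + 1]. *)
  rewrite muleA -EFinM -ge0_muleDl ?lee_fin ?mulr_ge0 ?addr_ge0 ?sqr_ge0//.
  rewrite -EFinD lee_wpmul2r// lee_fin -[n.+2%:R]natr1 le_eqVlt.
  apply/orP; left.
  by apply/eqP; field; rewrite lt0r_neq0.
(* Translation invariance lets the increment over [z *+ n.+1] start at [x + z], so that it joins the
   increment over [z]. *)
have <- : (\int[mu]_x ((u ((x + z) + z *+ n.+1)%R - u (x + z)%R)%R ^+ 2)%:E)%E =
    shift_dist (z *+ n.+1).
  rewrite (@ge0_integral_rV_shift R d z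
     (fun x => ((u (x + z *+ n.+1)%R - u x)%R ^+ 2)%:E))//.
    exact/measurable_EFinP.
  by move=> x; rewrite lee_fin sqr_ge0.
have msh2 : measurable_fun setT
    (fun x : V => ((u (x + z + z *+ n.+1)%R - u (x + z)%R)%R ^+ 2)).
  exact: (measurableT_comp (msh (z *+ n.+1)) (measurable_rV_shift z)).
rewrite [shift_dist z]/shift_dist -!ge0_integralZl//; last 4 first.
- exact/measurable_EFinP.
- by move=> x _; rewrite lee_fin sqr_ge0.
- exact/measurable_EFinP.
- by move=> x _; rewrite lee_fin sqr_ge0.
rewrite -ge0_integralD//; last 4 first.
- by move=> x _; rewrite mule_ge0// lee_fin ?sqr_ge0// addr_ge0.
- by apply: measurable_funeM; exact/measurable_EFinP.
- by move=> x _; rewrite mule_ge0// lee_fin ?sqr_ge0// addr_ge0.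
- by apply: measurable_funeM; exact/measurable_EFinP.
apply: ge0_le_integral => //.
- by move=> x _; rewrite lee_fin sqr_ge0.
- exact/measurable_EFinP.
- by apply: emeasurable_funD; apply: measurable_funeM; exact/measurable_EFinP.
move=> x _; rewrite -!EFinM -EFinD lee_fin -addrA -mulrS.
move: (u (x + z *+ n.+2)) (u (x + z)) (u x) => a b c.
set t : R := n.+1%:R in n0 *.
(* The two sides of the weighted inequality differ by a perfect square over [t]. *)
rewrite -subr_ge0 [leRHS](_ : _ = t^-1 * ((a - b) - t * (b - c)) ^+ 2).
  by rewrite mulr_ge0 ?sqr_ge0// invr_ge0 ltW.
by field; rewrite lt0r_neq0.
Qed.

(** Wherever [u] is nonzero the increment is exactly [- u x]. *)
Lemma sqr_le_shift_dist (z : V) : (forall x, u x != 0 -> u (x + z) = 0) ->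
  (\int[mu]_x (u x ^+ 2)%:E <= shift_dist z)%E.
Proof.
move=> uz; apply: ge0_le_integral => //.
- by move=> x _; rewrite lee_fin sqr_ge0.
- by apply/measurable_EFinP; exact: measurable_funX.
- exact/measurable_EFinP.
move=> x _; rewrite lee_fin; have [->|/uz ->] := eqVneq (u x) 0.
  by rewrite expr0n sqr_ge0.
by rewrite sub0r sqrrN.
Qed.

(** For fixed [x], substitute [x' = x + z] by translation invariance; then exchange the order of
    integration, so that the kernel depends on the outer variable alone. *)
Lemma integral_nl_integrand (delta : R) :
  (\int[mu2]_p (nl_integrand delta u u p)%:E =
   \int[mu]_z ((kernel delta z)%:E * shift_dist z))%E.
Proof.
have mN := measurable_nl_integrand delta mu_ mu_.
have N0 p : (0 <= nl_integrand delta u u p).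
  by rewrite /nl_integrand -mulrA mulr_ge0 ?kernel_ge0// -expr2 sqr_ge0.
pose G (p : V * V) := kernel delta p.2 * (u (p.1 + p.2) - u p.1) ^+ 2.
have mG : measurable_fun setT G.
  apply: measurable_funM.
    exact: (measurableT_comp (measurable_nl_kernel delta) measurable_snd).
  apply: measurable_funX; apply: measurable_funB.
    exact: (measurableT_comp mu_ measurable_rVD).
  exact: (measurableT_comp mu_ measurable_fst).
have G0 p : 0 <= G p by rewrite mulr_ge0 ?kernel_ge0 ?sqr_ge0.
rewrite fubini_tonelli1//; last exact/measurable_EFinP.
transitivity (\int[mu]_x \int[mu]_z (G (x, z))%:E)%E.
  apply: eq_integral => x _; rewrite /fubini_F.
  rewrite -[LHS](@ge0_integral_rV_shift R d x); last 2 first.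
  - apply/measurable_EFinP; exact: (measurableT_comp mN (pair1_measurable x)).
  - by move=> y; rewrite lee_fin.
  apply: eq_integral => z _; rewrite /nl_integrand /G/= -mulrA -expr2 (addrC z).
  by rewrite opprD addNKr kernelN.
rewrite (@fubini_tonelli _ _ _ _ _ mu mu (EFin \o G))//; last exact/measurable_EFinP.
apply: eq_integral => z _; rewrite /= /shift_dist -ge0_integralZl//.
- exact/measurable_EFinP.
- by move=> x _; rewrite lee_fin sqr_ge0.
- by rewrite lee_fin kernel_ge0.
Qed.

End poincare.

(** The half is that of the form, [(2 * d)^-1 ^+ d] is the volume of the cube of increments divided
    by [delta ^+ d], and [4 * d * M + 1] bounds [delta] times the number of translations. *)
Definition poincare_cst (R : realType) (d : nat) (M : R) : R :=
  2^-1 * ((2 * d%:R)^-1 ^+ d / (4 * d%:R * M + 1) ^+ 2).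

Lemma poincare_cst_gt0 (R : realType) (d : nat) (M : R) :
  (0 < d)%N -> 0 <= M -> 0 < poincare_cst d M.
Proof.
move=> d0 M0; rewrite /poincare_cst mulr_gt0// divr_gt0// exprn_gt0//.
  by rewrite invr_gt0 mulr_gt0// ltr0n.
by rewrite ltr_wpDl// !mulr_ge0.
Qed.

Section poincare.
Context {R : realType} {d : nat}.
Local Notation mu := (@lebesgue_rV R d).
Local Notation mu2 := (mu \x mu)%E.
Local Notation V := 'rV[R]_d.

(** A single coordinate [i0] serves to move the support off itself, so it is enough that [u] is
    supported in a slab. *)
Lemma nl_integrand_ge (delta M : R) (i0 : 'I_d) (u : V -> R) :
  0 < delta -> delta <= 1 -> 0 <= M -> sqr_integrable u ->
  (forall x : V, M < `|x ord0 i0| -> u x = 0) ->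
  poincare_cst d M * delta ^+ (d + 2) * \int[mu]_x (u x ^+ 2) <=
  2^-1 * \int[mu2]_p nl_integrand delta u u p.
Proof.
move=> delta0 delta1 M0 hu uM; have [mu_ iu] := hu.
have d0 : (0 : R) < d%:R by rewrite ltr0n (leq_ltn_trans _ (ltn_ord i0)).
(* The increments [z] range over the cube [[c, 2c]^d]. *)
pose c := delta / (2 * d%:R).
have c0 : 0 < c by rewrite divr_gt0// mulr_gt0.
(* The successor makes [2 * M < m * c] strict and [m] nonzero even if [M = 0]. *)
pose m := (Num.truncn (2 * M / c)).+1.
have m0 : (0 : R) < m%:R by [].
have Mc0 : 0 <= 2 * M / c by rewrite divr_ge0 ?mulr_ge0// ltW.
have mc : 2 * M < m%:R * c.
  rewrite -ltr_pdivrMr//; have := truncn_itv Mc0.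
  by move=> /andP[].
have mle : m%:R <= (4 * d%:R * M + 1) / delta.
  have := truncn_itv Mc0 => /andP[+ _].
  move=> h; rewrite /m -[leLHS]natr1.
  apply: (@le_trans _ _ (2 * M / c + 1)); first by rewrite lerD2r.
  (* Here [2 * M / c] equals [4 * d * M / delta], and the added 1 is absorbed by [1 / delta] because
     [delta <= 1]. *)
  rewrite [leRHS]mulrDl mul1r lerD//; last by rewrite -[leLHS]invr1 lef_pV2 ?posrE.
  rewrite /c le_eqVlt; apply/orP; left; apply/eqP; field.
  by rewrite !lt0r_neq0.
pose l : V := const_mx c; pose r : V := const_mx (2 * c).
have mB : measurable (rV_box l r) by exact: measurable_rV_box.
set I : R := \int[mu]_x (u x ^+ 2).
have IE : (\int[mu]_x (u x ^+ 2)%:E)%E = I%:E.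
  by rewrite fineK//; exact: integrable_fin_num.
have I0 : 0 <= I by apply: Rintegral_ge0 => x _; exact: sqr_ge0.
have Dz z : rV_box l r z -> (I%:E <= (m%:R ^+ 2)%:E * shift_dist u z)%E.
  move=> zB; apply: le_trans (shift_distMn mu_ z m); rewrite -IE.
  apply: sqr_le_shift_dist => // x ux; apply: (uM).
  have : `|x ord0 i0| <= M by rewrite leNgt; apply: contra ux => /uM ->.
  rewrite ler_norml => /andP[x1 x2].
  have /andP[] := zB i0; rewrite !mxE => z1 z2.
  (* A point with coordinate at least [- M] is thus sent beyond [M], where [u] vanishes. *)
  have zx : 2 * M < m%:R * z ord0 i0.
    by apply: lt_le_trans mc _; rewrite ler_pM2l.
  rewrite mulmxnE -[_ *+ m]mulr_natl; apply: lt_le_trans (ler_norm _); lra.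
(* The coordinates are at most [2 * c = delta / d], so the cube lies in the ball of radius
   [delta]. *)
have kz z : rV_box l r z -> kernel delta z = 1.
  move=> zB; rewrite /kernel ifT//.
  apply: (@le_trans _ _ (d%:R * (2 * c))).
    apply: eucl_norm_le_coord => [|i]; first by rewrite mulr_ge0// ltW.
    have /andP[] := zB i; rewrite !mxE => z1 z2.
    by rewrite ger0_norm//; apply: le_trans z1; rewrite ltW.
  by rewrite /c le_eqVlt; apply/orP; left; apply/eqP; field; rewrite lt0r_neq0.
have mD : measurable_fun setT (shift_dist u).
  have mG : measurable_fun setT (fun p : V * V => ((u (p.2 + p.1) - u p.2) ^+ 2)%:E).
    apply/measurable_EFinP; apply: measurable_funX; apply: measurable_funB.
      exact: (measurableT_comp mu_ (measurableT_comp measurable_rVD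
        (measurable_fun_pair measurable_snd measurable_fst))).
    exact: (measurableT_comp mu_ measurable_snd).
  by apply: (@measurable_fun_fubini_tonelli_F _ _ V V R mu _ mG) => p; rewrite lee_fin sqr_ge0.
have key : (((m%:R ^+ 2)^-1 * I * c ^+ d)%:E <=
    \int[mu2]_p (nl_integrand delta u u p)%:E)%E.
  rewrite integral_nl_integrand//.
  (* Outside the cube the integrand is only bounded below by 0; on the cube, of volume [c ^+ d], it
     is at least [I / m^2]. *)
  apply: (@le_trans _ _ (\int[mu]_z ((m%:R ^+ 2)^-1 * I * \1_(rV_box l r) z)%:E)%E).
    under eq_integral do rewrite EFinM.
    rewrite ge0_integralZl//; last 2 first.
    - by apply/measurable_EFinP; exact/measurable_indicP.
    - by rewrite lee_fin mulr_ge0// invr_ge0 sqr_ge0.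
    rewrite integral_indic// setIT [X in (_ * X)%E]lebesgue_rV_box; last first.
      by move=> i; rewrite !mxE; lra.
    rewrite -EFinM lee_fin (eq_bigr (fun=> c)) ?prodr_const ?card_ord//.
    by move=> i _; rewrite !mxE; lra.
  apply: ge0_le_integral => //.
  - by move=> z _; rewrite lee_fin !mulr_ge0// invr_ge0 sqr_ge0.
  - apply/measurable_EFinP; apply: measurable_funM; first exact: measurable_cst.
    by apply/measurable_indicP.
  - by apply: emeasurable_funM => //; apply/measurable_EFinP; exact: measurable_nl_kernel.
  move=> z _; rewrite indicE; have [/set_mem zB|_] := boolP (z \in rV_box l r).
    rewrite kz// mul1e mulr1 EFinM lee_pdivrMl; last by rewrite exprn_gt0.
    exact: Dz.
  rewrite mulr0 mule_ge0// ?lee_fin ?kernel_ge0//.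
  by apply: integral_ge0 => x _; rewrite lee_fin sqr_ge0.
rewrite -[X in _ <= _ * X]/(fine _) /poincare_cst -!mulrA ler_wpM2l//.
rewrite -lee_fin fineK; last first.
  by apply: integrable_fin_num => //; apply: integrable_nl_integrand => //; exact: ltW.
apply: le_trans key; rewrite lee_fin.
rewrite [leRHS](_ : _ = (2 * d%:R)^-1 ^+ d * (delta ^+ d * ((m%:R ^+ 2)^-1 * I))); last first.
  by rewrite /c exprMn; ring.
rewrite ler_wpM2l ?exprn_ge0 ?invr_ge0 ?mulr_ge0//.
set K := 4 * (d%:R * M) + 1.
have K0 : 0 < K by rewrite ltr_wpDl// !mulr_ge0.
have mK : K ^- 2 * delta ^+ 2 <= (m%:R ^+ 2)^-1.
  rewrite -[K ^- 2]exprVn -exprMn -[leRHS]exprVn lerXn2r ?nnegrE ?mulr_ge0 ?invr_ge0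
    ?(ltW K0) ?(ltW delta0)//.
  rewrite -[leLHS]invrK invfM invrK lef_pV2 ?posrE ?divr_gt0//.
  by apply: le_trans mle _; rewrite /K mulrA.
rewrite exprD [leLHS](_ : _ = delta ^+ d * (K ^- 2 * delta ^+ 2 * I)); last by ring.
by rewrite ler_wpM2l ?exprn_ge0 ?(ltW delta0)// ler_wpM2r.
Qed.

End poincare.

(** * Restriction to the domain *)

Section open_rV.
Context {R : realType} {n : nat}.
Local Notation V := 'rV[R]_n.
Implicit Types (x y : V) (U : set V).

Lemma coord_le_norm x i : `|x ord0 i| <= `|x|.
Proof.
rewrite [leRHS]/Num.Def.normr/= mx_normrE.
exact: (le_bigmax _ (fun ij : 'I_1 * 'I_n => `|x ij.1 ij.2|) (ord0, i)).
Qed.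

Let rbox (q : 'rV[rat]_n * nat) : set V :=
  rV_box (\row_i (ratr (q.1 ord0 i) - q.2.+1%:R^-1))
         (\row_i (ratr (q.1 ord0 i) + q.2.+1%:R^-1)).

(** An open set is the union of those boxes [rbox q] that it contains, and there are countably many
    of them. This links the topology with the sigma-algebra generated by the coordinates. *)
Lemma open_rV_measurable U : open U -> measurable U.
Proof.
move=> oU.
rewrite (_ : U = \bigcup_q (if `[< rbox q `<=` U >] then rbox q else set0)).
  apply: countable_bigcupT_measurable => [|q]; first exact: countableP.
  by case: ifP => _; [exact: measurable_rV_box|exact: measurable0].
apply/seteqP; split => [x Ux|x [q _]]; last by case: ifPn => // /asboolP; apply.
have /nbhs_ballP[e /= e0 xeU] : nbhs x U by exact: open_nbhs_nbhs.
(* With a centre within [1 / (m + 1)] of [x], all points of the box are within [2 / (m + 1) < e] of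
   [x]. *)
pose m := Num.truncn (2 / e).
have me : 2 * m.+1%:R^-1 < e.
  have := truncn_itv (divr_ge0 (ler0n R 2) (ltW e0)) => /andP[_].
  by rewrite ltr_pdivrMr// -ltr_pdivrMl// mulrC.
have m0 : (0 : R) < m.+1%:R^-1 by rewrite invr_gt0.
have /choice[q qx] i : exists q : rat,
    x ord0 i - m.+1%:R^-1 < ratr q < x ord0 i + m.+1%:R^-1.
  have /rat_in_itvoo[q] : x ord0 i - m.+1%:R^-1 < x ord0 i + m.+1%:R^-1 .
    by rewrite ltrBlDr -addrA ltrDl addr_gt0.
  by rewrite in_itv/= => qi; exists q.
exists (\row_i q i, m) => //; rewrite ifT.
  move=> i; rewrite /= !mxE; move: (m.+1%:R^-1) (qx i) => r /andP[? ?].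
  by apply/andP; split; lra.
apply/asboolP => y yb; apply: xeU; split => // i j.
rewrite ord1 /ball/=; have := yb j; rewrite !mxE/=.
move: (m.+1%:R^-1) me m0 (qx j) => r me r0 /andP[? ?] /andP[? ?].
by rewrite ltr_norml; apply/andP; split; lra.
Qed.

End open_rV.

(** * Measurability of the nonlocal closure *)

Section nl_closure.
Context {R : realType} {d : nat}.
Local Notation V := 'rV[R]_d.
Variables (delta : R) (Om : set V).
Hypotheses (oOm : open Om) (Om0 : Om !=set0).

Let dist_has_lbound x : has_lbound [set eucl_norm (x - y) | y in Om].
Proof. by exists 0 => _ [y _ <-]; exact: sqrtr_ge0. Qed.

Lemma dist_to_le x y : Om y -> dist_to x Om <= eucl_norm (x - y).
Proof. by move=> Omy; apply: ge_inf => //; exists y. Qed.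

Lemma continuous_eucl_norm_sub (y : V) :
  continuous (fun x : V => eucl_norm (x - y)).
Proof.
have cS : continuous (fun x : V => \sum_i (x - y) ord0 i ^+ 2).
  apply: continuous_big => [|i _ x]; first exact: add_continuous.
  apply: (continuous_comp (f := fun x : V => (x - y) ord0 i) (g := fun a => a ^+ 2)).
    have -> : (fun x : V => (x - y) ord0 i) = (fun x => x ord0 i - y ord0 i).
      by apply/funext => z; rewrite !mxE.
    by apply: continuousB; [exact: coord_continuous|exact: cst_continuous].
  exact: exprn_continuous.
move=> x; rewrite (_ : (fun _ => _) =
  @Num.sqrt R \o (fun x => \sum_i (x - y) ord0 i ^+ 2))//.
apply: continuous_comp; first exact: cS.
exact: sqrt_continuous.
Qed.

(** The infimum in the distance need not be attained, so the sublevel set is written as a countable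
    intersection, over [k], of the open [delta + 1/(k+1)]-neighbourhoods of [Om]. *)
Lemma measurable_nl_closure : measurable (nl_closure delta Om).
Proof.
have mOm := open_rV_measurable oOm.
have -> : nl_closure delta Om =
    Om `|` (~` Om `&` [set x | dist_to x Om <= delta]) by [].
apply: measurableU => //; apply: measurableI; first exact: measurableC.
have -> : [set x | dist_to x Om <= delta] = \bigcap_k
    [set x | exists2 y, Om y & eucl_norm (x - y) < delta + k.+1%:R^-1].
  apply/seteqP; split => x /=.
    move=> xd k _ /=; have : dist_to x Om < delta + k.+1%:R^-1.
      by rewrite (le_lt_trans xd)// ltrDl invr_gt0.
    have dne : [set eucl_norm (x - y) | y in Om] !=set0.
      by case: Om0 => y Omy; exists (eucl_norm (x - y)); exists y.
    by move=> /(inf_lt dne)[_ [y Omy <-] ?]; exists y.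
  move=> xk; apply/ler_addgt0Pr => e e0.
  pose k := Num.truncn e^-1.
  have [y Omy xy] := xk k I; apply: (le_trans (dist_to_le x Omy)).
  rewrite (le_trans (ltW xy))// lerD2l -[leRHS]invrK lef_pV2 ?posrE ?invr_gt0//.
  by have /truncn_itv/andP[_ /ltW] : 0 <= e^-1 by rewrite invr_ge0 ltW.
apply: bigcap_measurable => // k _; apply: open_rV_measurable.
rewrite (_ : [set _ | _] = \bigcup_(y in Om)
   [set x | eucl_norm (x - y) < delta + k.+1%:R^-1]).
  apply: bigcup_open => y _.
  apply: (@open_comp _ _ _ [set r | r < delta + k.+1%:R^-1]); last exact: open_lt.
  by move=> x _; exact: continuous_eucl_norm_sub.
by apply/seteqP; split => [x [y]|x [y]]; exists y.
Qed.

End nl_closure.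

Section Rintegral_extra.
Context d1 d2 (T1 : measurableType d1) (T2 : measurableType d2) (R : realType).
Variables (m1 : {sigma_finite_measure set T1 -> \bar R})
          (m2 : {sigma_finite_measure set T2 -> \bar R}).

(** The inner real integral is the [fine] part of the extended one, and they agree only where the
    section is integrable, that is, for almost every [x]. *)
Lemma Rintegral_fubini (f : T1 * T2 -> R) :
  (m1 \x m2)%E.-integrable setT (EFin \o f) ->
  \int[(m1 \x m2)%E]_p f p = \int[m1]_x \int[m2]_y f (x, y).
Proof.
move=> fi; rewrite /Rintegral -(integral12_prod_meas1 fi); congr fine.
apply: ae_eq_integral => //.
- exact: (measurable_fubini_F fi).
- apply/measurable_EFinP; apply: measurableT_comp; first exact: fine_measurable.
  exact: (measurable_fubini_F fi).
apply: filterS (ae_integrable1 fi) => x xi _ /=.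
by rewrite fineK//; exact: integrable_fin_num.
Qed.

End Rintegral_extra.

Section ae_eq_Rintegral.
Context d (T : measurableType d) (R : realType) (m : {measure set T -> \bar R}).

Lemma ae_eq_Rintegral (f g : T -> R) :
  measurable_fun setT f -> measurable_fun setT g ->
  {ae m, forall x, f x = g x} -> \int[m]_x f x = \int[m]_x g x.
Proof.
move=> mf mg fg; congr fine; apply: ae_eq_integral => //; [exact/measurable_EFinP..|].
by apply: filterS fg => x -> _.
Qed.

End ae_eq_Rintegral.

Section reduction.
Context {R : realType} {d : nat}.
Local Notation mu := (@lebesgue_rV R d).
Local Notation mu2 := (mu \x mu)%E.
Local Notation V := 'rV[R]_d.
Variables (delta : R) (Om : set V).
Hypotheses (d0 : 0 <= delta) (oOm : open Om) (Om0 : Om !=set0).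
Local Notation S := (nl_closure delta Om).

Let mOm : measurable Om. Proof. exact: open_rV_measurable. Qed.
Let mS : measurable S. Proof. exact: measurable_nl_closure. Qed.

Lemma patch_sqr (A : set V) (u : V -> R) :
  (fun x => ((u \_ A) x ^+ 2)%:E) = (fun x => (u x ^+ 2)%:E) \_ A.
Proof. by apply/funext => x; rewrite !patchE; case: ifP => // _; rewrite expr0n. Qed.

Lemma sqr_integrable_patch (A : set V) (u : V -> R) : measurable A -> A `<=` S ->
  L20 delta Om u -> sqr_integrable (u \_ A).
Proof.
move=> mA AS [mu_ ui _]; split.
  by apply/(measurable_restrictT _ mA); apply: measurable_funS mu_.
rewrite patch_sqr; apply/(integrable_mkcond _ mA).
exact: (integrableS mS).
Qed.

Let OmS : Om `<=` S. Proof. by move=> x; left. Qed.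

(** The two cut-offs differ only on the nonlocal boundary, where [u] is 0 almost everywhere. *)
Lemma L20_ae (u : V -> R) : L20 delta Om u -> {ae mu, forall x, (u \_ S) x = (u \_ Om) x}.
Proof.
move=> [_ _]; apply: filterS => x ux; rewrite !patchE.
have [/set_mem Omx|/negP nOmx] := boolP (x \in Om); first by rewrite mem_set//; left.
case: ifPn => // /set_mem[|/ux//] Omx; by case: nOmx; exact: mem_set.
Qed.

Lemma L2_normsqE u : L20 delta Om u ->
  L2_normsq delta Om u = \int[mu]_x ((u \_ Om) x ^+ 2).
Proof.
move=> hu; rewrite /L2_normsq Rintegral_mkcond.
have [m1 _] := sqr_integrable_patch mS (@subset_refl _ _) hu.
have [m2 _] := sqr_integrable_patch mOm OmS hu.
have -> : (fun x => u x ^+ 2) \_ S = (fun x => (u \_ S) x ^+ 2).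
  by apply/funext => x; rewrite !patchE; case: ifP => // _; rewrite expr0n.
apply: ae_eq_Rintegral; [exact: measurable_funX..|].
by apply: filterS (L20_ae hu) => x ->.
Qed.

(** The cylinder over a null set is null, since 0 times an infinite measure is 0 in the extended
    reals. *)
Lemma ae_fst (P : V -> Prop) : {ae mu, forall x, P x} -> {ae mu2, forall p, P p.1}.
Proof.
move=> [N [mN N0 PN]]; exists (N `*` setT); split; first exact: measurableX.
- by rewrite product_measure1E// [X in (X * _)%E]N0 mul0e.
- by move=> p /= /PN.
Qed.

Lemma ae_snd (P : V -> Prop) : {ae mu, forall x, P x} -> {ae mu2, forall p, P p.2}.
Proof.
move=> [N [mN N0 PN]]; exists (setT `*` N); split; first exact: measurableX.
- by rewrite product_measure1E// [X in (_ * X)%E]N0 mule0.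
- by move=> p /= /PN.
Qed.

(** Here the thickness of the boundary meets the horizon: [y] is within [delta] of the point [x] of
    [Om]. *)
Lemma kernel_nl_closure x y : Om x -> kernel delta (x - y) != 0 -> S y.
Proof.
move=> Omx; rewrite /kernel; case: ifPn => [xy _|]; last by rewrite eqxx.
have [Omy|nOmy] := pselect (Om y); [by left|right; split => //].
by apply: le_trans (dist_to_le y Omx) _; rewrite -eucl_normN opprB.
Qed.

(** One point lies outside the closure. If the other is in [Om] the kernel vanishes; if not, both
    points carry the value 0. *)
Lemma nl_integrand_notin u v p : ~ S p.1 \/ ~ S p.2 ->
  nl_integrand delta (u \_ Om) (v \_ Om) p = 0.
Proof.
have out w x : ~ S x -> (w \_ Om : V -> R) x = 0.
  by move=> Sx; rewrite patchE memNset// => Omx; apply: Sx; left.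
have k0 x y : Om x -> ~ S y -> kernel delta (x - y) = 0.
  by move=> Omx Sy; apply/eqP/negPn/negP => /(kernel_nl_closure Omx).
rewrite /nl_integrand => -[Sp|Sp]; rewrite !(out _ _ Sp) ?subr0 ?sub0r.
  have [Omp|Omp] := pselect (Om p.2); last by rewrite !patchE memNset// !mulr0.
  by rewrite -kernelN opprB k0// !mul0r.
have [Omp|Omp] := pselect (Om p.1); last by rewrite !patchE memNset// oppr0 !mulr0.
by rewrite k0// !mul0r.
Qed.

(** By Fubini the iterated integral over the closure is that of [H], cut off in both variables.
    Almost everywhere [H] is the integrand of the functions cut off to [Om]: the boundary values
    vanish, and pairs not both in the closure contribute nothing. *)
Lemma nl_formE u v : L20 delta Om u -> L20 delta Om v ->
  nl_form delta Om u v =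
  2^-1 * \int[mu2]_p nl_integrand delta (u \_ Om) (v \_ Om) p.
Proof.
move=> hu hv; congr (_ * _).
have uS := sqr_integrable_patch mS (@subset_refl _ _) hu.
have vS := sqr_integrable_patch mS (@subset_refl _ _) hv.
have uO := sqr_integrable_patch mOm OmS hu.
have vO := sqr_integrable_patch mOm OmS hv.
pose H (p : V * V) := \1_S p.1 * \1_S p.2 * nl_integrand delta (u \_ S) (v \_ S) p.
have mF : measurable_fun setT (nl_integrand delta (u \_ S) (v \_ S)).
  by apply: measurable_nl_integrand; [case: uS|case: vS].
have mH : measurable_fun setT H.
  have m1S : measurable_fun setT (\1_S : V -> R) by exact/measurable_indicP.
  apply: measurable_funM => //; apply: measurable_funM.
    exact: (measurableT_comp m1S measurable_fst).
  exact: (measurableT_comp m1S measurable_snd).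
have iH : mu2.-integrable setT (EFin \o H).
  apply: le_integrable (integrable_nl_integrand d0 uS vS) => //.
    exact/measurable_EFinP.
  move=> p _; rewrite !abse_EFin lee_fin /H normrM ler_piMl// !indicE.
  by case: (_ \in _); case: (_ \in _); rewrite ?(mulr0, mul0r, mulr1, normr0, normr1).
transitivity (\int[mu2]_p H p).
  rewrite Rintegral_fubini// Rintegral_mkcond; apply: eq_Rintegral => x _.
  rewrite patchE; case: ifPn => xS; last first.
    rewrite /Rintegral (eq_integral (cst 0%E)) ?integral0// => y _.
    by rewrite /H indicE/= (negbTE xS) !mul0r.
  rewrite Rintegral_mkcond; apply: eq_Rintegral => y _.
  rewrite patchE /H !indicE/= xS mul1r; case: ifPn => yS; last by rewrite mul0r.
  by rewrite mul1r /nl_integrand !patchE/= xS yS.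
apply: ae_eq_Rintegral => //.
  by apply: measurable_nl_integrand; [case: uO|case: vO].
have uv : {ae mu, forall x, (u \_ S) x = (u \_ Om) x /\ (v \_ S) x = (v \_ Om) x}.
  by apply: filterS2 (L20_ae hu) (L20_ae hv).
apply: filterS2 (ae_fst uv) (ae_snd uv) => p [u1 v1] [u2 v2].
rewrite /H /nl_integrand u1 u2 v1 v2 -/(nl_integrand delta (u \_ Om) (v \_ Om) p).
rewrite !indicE.
have [p1|/negP p1] := boolP (p.1 \in S); last first.
  by rewrite !mul0r; apply/esym/nl_integrand_notin; left => /mem_set.
have [p2|/negP p2] := boolP (p.2 \in S); first by rewrite !mul1r.
by rewrite mulr0 mul0r; apply/esym/nl_integrand_notin; right => /mem_set.
Qed.

End reduction.

(** * Quadratic forms *)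

Section Rintegral_sum.
Context d (T : measurableType d) (R : realType) (m : {measure set T -> \bar R}).

Lemma integrable_EFin_sum (I : Type) (s : seq I) (f : I -> T -> R) :
  (forall i, m.-integrable setT (EFin \o f i)) ->
  m.-integrable setT (EFin \o (fun x => \sum_(i <- s) f i x)).
Proof.
move=> fi; rewrite (_ : _ \o _ = (fun x => (\sum_(i <- s) (f i x)%:E)%E)).
  by apply: integrable_sum => // i _; exact: fi.
by apply/funext => x; rewrite /= sumEFin.
Qed.

Lemma Rintegral_sum (I : Type) (s : seq I) (f : I -> T -> R) :
  (forall i, m.-integrable setT (EFin \o f i)) ->
  \int[m]_x (\sum_(i <- s) f i x) = \sum_(i <- s) \int[m]_x f i x.
Proof.
move=> fi; elim: s => [|i s IH].
  by under eq_Rintegral do rewrite big_nil; rewrite Rintegral_cst// mul0r big_nil.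
rewrite big_cons -IH -RintegralD//; last exact: integrable_EFin_sum.
by under eq_Rintegral do rewrite big_cons.
Qed.

End Rintegral_sum.

Section quadratic_form.
Context {R : realType} {d : nat}.
Local Notation mu := (@lebesgue_rV R d).
Local Notation mu2 := (mu \x mu)%E.
Local Notation V := 'rV[R]_d.

Lemma sqr_integrableZ (c : R) (u : V -> R) :
  sqr_integrable u -> sqr_integrable (fun x => c * u x).
Proof.
move=> [mu_ iu]; split; first exact: measurable_funM.
under eq_fun do rewrite exprMn EFinM.
exact: integrableZl.
Qed.

Lemma sqr_integrableD (u v : V -> R) :
  sqr_integrable u -> sqr_integrable v -> sqr_integrable (fun x => u x + v x).
Proof.
move=> [mu_ iu] [mv iv]; split; first exact: measurable_funD.
apply: le_integrable (integrableZl measurableT 2 (integrableD measurableT iu iv)) => //.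
  by apply/measurable_EFinP; apply: measurable_funX; exact: measurable_funD.
move=> x _ /=; rewrite lee_fin ger0_norm ?sqr_ge0// ger0_norm.
  by have := sqr_ge0 (u x - v x); nra.
by rewrite mulr_ge0// addr_ge0// sqr_ge0.
Qed.

Lemma sqr_integrable_sum (I : Type) (s : seq I) (u : I -> V -> R) :
  (forall i, sqr_integrable (u i)) -> sqr_integrable (fun x => \sum_(i <- s) u i x).
Proof.
move=> hu; elim: s => [|i s IH].
  under eq_fun do rewrite big_nil; split => //.
  by under eq_fun do rewrite expr0n/=; exact: integrable0.
by under eq_fun do rewrite big_cons; exact: sqr_integrableD.
Qed.

(** Bilinearity; the order of [u j] and [u i] follows the entries of the stiffness matrix. *)
Lemma Rintegral_nl_integrand_sum (delta : R) n (c : 'I_n -> R) (u : 'I_n -> V -> R) :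
  0 <= delta -> (forall i, sqr_integrable (u i)) ->
  let w x := \sum_i c i * u i x in
  \int[mu2]_p nl_integrand delta w w p =
  \sum_i \sum_j c i * c j * \int[mu2]_p nl_integrand delta (u j) (u i) p.
Proof.
move=> d0 hu w.
have wE p : nl_integrand delta w w p =
    \sum_i \sum_j c i * c j * nl_integrand delta (u j) (u i) p.
  have wB : w p.2 - w p.1 = \sum_i c i * (u i p.2 - u i p.1).
    by rewrite -sumrB; apply: eq_bigr => i _; rewrite mulrBr.
  rewrite /nl_integrand wB mulrC mulr_suml; apply: eq_bigr => i _.
  rewrite mulr_sumr mulr_sumr; apply: eq_bigr => j _; ring.
have ii i j : mu2.-integrable setT
    (EFin \o (fun p => c i * c j * nl_integrand delta (u j) (u i) p)).
  have := integrableZl measurableT (c i * c j) (integrable_nl_integrand d0 (hu j) (hu i)).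
  by apply: eq_integrable.
under eq_Rintegral do rewrite wE.
rewrite Rintegral_sum => [|i]; last exact: integrable_EFin_sum.
apply: eq_bigr => i _; rewrite Rintegral_sum//; apply: eq_bigr => j _.
by rewrite RintegralZl//; exact: integrable_nl_integrand.
Qed.

End quadratic_form.

(** * Cubes and multilinear functions *)

Section cube_geometry.
Context {R : realType} {d : nat}.
Local Notation V := 'rV[R]_d.
Variables (h : R) (h0 : 0 < h).
Implicit Types (Q : cube R d) (t s x y : V).

Lemma frame_orthogonalC Q : (frame Q)^T *m frame Q = 1%:M.
Proof. exact: mulmx1C (frame_orthogonal Q). Qed.

Lemma frame_le1 Q i j : `|frame Q i j| <= 1.
Proof.
have : (frame Q *m (frame Q)^T) i i = 1 by rewrite frame_orthogonal mxE eqxx.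
rewrite mxE (bigD1 j)//= mxE => F1.
rewrite -(@expr_le1 _ 2)// -normrX ger0_norm ?sqr_ge0// -F1 -expr2 lerDl.
by apply: sumr_ge0 => k _; rewrite mxE -expr2 sqr_ge0.
Qed.

(** Local coordinates: the inverse of [cube_point], the frame being inverted by its transpose. *)
Definition cube_coord Q y : V := h^-1 *: ((y - corner Q) *m (frame Q)^T).

Lemma cube_pointK Q : cancel (cube_point h Q) (cube_coord Q).
Proof.
move=> t; rewrite /cube_coord /cube_point addrC addKr -scalemxAl scalerA.
by rewrite mulVf ?lt0r_neq0// scale1r -mulmxA frame_orthogonal mulmx1.
Qed.

Lemma cube_coordK Q : cancel (cube_coord Q) (cube_point h Q).
Proof.
move=> y; rewrite /cube_coord /cube_point -scalemxAl scalerA.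
rewrite mulfV ?lt0r_neq0// scale1r -mulmxA frame_orthogonalC mulmx1.
by rewrite addrC subrK.
Qed.

(** Each coordinate is a sum of [d] terms with frame entries at most 1 in absolute value. Such crude
    bounds stand in for a change of variables on rotated cubes. *)
Lemma cube_point_dist Q t s (r : R) : (forall i, `|t ord0 i - s ord0 i| <= r) ->
  forall j, `|cube_point h Q t ord0 j - cube_point h Q s ord0 j| <= d%:R * h * r.
Proof.
move=> ts j; rewrite /cube_point !mxE opprD addrACA subrr add0r -mulrBr normrM.
rewrite gtr0_norm// [leRHS](_ : _ = h * (d%:R * r)); last by ring.
rewrite ler_pM2l// -sumrB.
rewrite (le_trans (ler_norm_sum _ _ _))//.
rewrite (@le_trans _ _ (\sum_(i < d) r))//; last first.
  by rewrite sumr_const card_ord mulr_natl.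
apply: ler_sum => i _; rewrite -mulrBl normrM.
by rewrite (le_trans (ler_piMr _ (frame_le1 Q i j))).
Qed.

Lemma cube_coord_dist Q x y (r : R) : (forall i, `|x ord0 i - y ord0 i| <= r) ->
  forall j, `|cube_coord Q x ord0 j - cube_coord Q y ord0 j| <= d%:R * r / h.
Proof.
move=> xy j; rewrite /cube_coord !mxE -mulrBr normrM gtr0_norm ?invr_gt0//.
rewrite mulrC ler_pM2r ?invr_gt0// -sumrB (le_trans (ler_norm_sum _ _ _))//.
rewrite (@le_trans _ _ (\sum_(i < d) r))//; last first.
  by rewrite sumr_const card_ord mulr_natl.
apply: ler_sum => i _; rewrite !mxE -mulrBl normrM.
rewrite (le_trans (ler_piMr _ (frame_le1 Q j i)))//.
by rewrite opprB addrA subrK.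
Qed.

Lemma open_cubeP Q y : open_cube h Q y <-> forall i, 0 < cube_coord Q y ord0 i < 1.
Proof.
split => [[t t01 <-] i|y01]; first by rewrite cube_pointK; exact: t01.
by exists (cube_coord Q y); rewrite ?cube_coordK.
Qed.

Lemma closed_cubeP Q y :
  closed_cube h Q y <-> forall i, 0 <= cube_coord Q y ord0 i <= 1.
Proof.
split => [[t t01 <-] i|y01]; first by rewrite cube_pointK; exact: t01.
by exists (cube_coord Q y); rewrite ?cube_coordK.
Qed.

Lemma measurable_open_cube Q : measurable (open_cube h Q).
Proof.
have mc i : measurable_fun setT (fun y => cube_coord Q y ord0 i).
  under eq_fun do rewrite !mxE; apply: measurable_funM => //.
  apply: measurable_sum => j.
  under eq_fun do rewrite !mxE; apply: measurable_funM => //.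
  by apply: measurable_funB => //; exact: measurable_rV_coord.
rewrite (_ : open_cube h Q = \bigcap_(i in [set: 'I_d])
   ((fun y => cube_coord Q y ord0 i) @^-1` `]0, 1[%classic)).
  apply: fin_bigcap_measurable => // i _; rewrite -[X in measurable X]setTI.
  exact: mc.
apply/seteqP; split => [y /open_cubeP y01 i _|y y01]; first by rewrite /= in_itv/=.
by apply/open_cubeP => i; have := y01 i I; rewrite /= in_itv.
Qed.

(** Distinct elements meet in a proper face, where some local coordinate is 0 or 1; in the open cube
    none is. *)
Lemma conforming_mesh_open_disjoint N (T : 'I_N -> cube R d) k l y :
  conforming_mesh h T -> open_cube h (T k) y -> closed_cube h (T l) y -> k = l.
Proof.
move=> cT ky ly; apply/eqP; apply/negPn/negP => kl.
have ky' : closed_cube h (T k) y.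
  by apply/closed_cubeP => i; move/open_cubeP : ky => /(_ i) /andP[/ltW -> /ltW ->].
have [I0|[f [g [[i fi] _ If _]]]] := cT _ _ kl.
  by have : set0 y by rewrite -I0.
have : face h (T k) f y by rewrite -If.
move=> [t /(_ i)]; case: (f i) fi => // b _ tb ty.
move/open_cubeP : ky => /(_ i); rewrite -ty cube_pointK tb.
by case: b {tb} => /=; rewrite ltxx ?andbF.
Qed.

Lemma open_closed_cube Q y : open_cube h Q y -> closed_cube h Q y.
Proof.
move=> /open_cubeP y01; apply/closed_cubeP => i.
by have /andP[/ltW -> /ltW ->] := y01 i.
Qed.

End cube_geometry.

Section multilinear.
Context {R : realType} {d : nat}.
Implicit Types (a : {set 'I_d} -> R) (t : 'rV[R]_d).

Definition multilinear a t : R := \sum_(J : {set 'I_d}) a J * \prod_(i in J) t ord0 i.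

(** Each coordinate has two candidate values and [f] selects one. The choice 0 or 1 gives the
    vertices, [s i] or [s i + 1/2] the translates by half-edges. *)
Definition pick_row (P : 'I_d -> bool -> R) (f : {ffun 'I_d -> bool}) : 'rV[R]_d :=
  \row_i P i (f i).

(** The function is affine in each variable, so writing each coordinate as an affine combination of
    two values and expanding the product gives tensor weights. Weights may be negative, which allows
    extrapolation. *)
Lemma multilinear_interpolation a (w P : 'I_d -> bool -> R) t :
  (forall i, w i true + w i false = 1) ->
  (forall i, w i true * P i true + w i false * P i false = t ord0 i) ->
  multilinear a t =
  \sum_(f : {ffun 'I_d -> bool}) \prod_i w i (f i) * multilinear a (pick_row P f).
Proof.
move=> w1 wP; rewrite /multilinear; under [RHS]eq_bigr do rewrite mulr_sumr.
rewrite exchange_big/=; apply: eq_bigr => J _.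
under [RHS]eq_bigr do rewrite mulrCA.
rewrite -mulr_sumr; congr (_ * _).
transitivity (\prod_i \sum_(e : bool) w i e * (if i \in J then P i e else 1)).
  rewrite big_mkcond/=; apply: eq_bigr => i _; rewrite big_bool.
  by case: ifP => _; rewrite /= ?mulr1 ?wP ?w1.
rewrite bigA_distr_bigA/=; apply: eq_bigr => f _; rewrite big_split/=; congr (_ * _).
by rewrite [RHS]big_mkcond/=; apply: eq_bigr => i _; rewrite mxE.
Qed.

(** Cauchy-Schwarz against the constant 1, through [b i * b j <= (b i ^+ 2 + b j ^+ 2) / 2]. *)
Lemma sqr_sum_le (I : finType) (b : I -> R) :
  (\sum_i b i) ^+ 2 <= #|I|%:R * \sum_i b i ^+ 2.
Proof.
rewrite expr2 mulr_suml.
apply: (@le_trans _ _ (\sum_i \sum_j (b i ^+ 2 + b j ^+ 2) / 2)).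
  apply: ler_sum => i _; rewrite mulr_sumr; apply: ler_sum => j _.
  by have := sqr_ge0 (b i - b j); nra.
under eq_bigr do rewrite -mulr_suml big_split/=.
rewrite -mulr_suml big_split/= sumr_const.
under eq_bigr do rewrite sumr_const.
rewrite sumrMnl -[X in X + _]mulr_natl -[X in _ + X]mulr_natl; lra.
Qed.

(** Interpolation has [2 ^ d] terms, whence a factor [2 ^ d] by Cauchy-Schwarz, and each tensor
    weight is at most [c ^+ d] in absolute value. *)
Lemma multilinear_sqr_le a (w P : 'I_d -> bool -> R) t (c : R) :
  (forall i, w i true + w i false = 1) ->
  (forall i, w i true * P i true + w i false * P i false = t ord0 i) ->
  (forall i e, `|w i e| <= c) ->
  multilinear a t ^+ 2 <= (2 * c ^+ 2) ^+ d *
    \sum_(f : {ffun 'I_d -> bool}) multilinear a (pick_row P f) ^+ 2.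
Proof.
move=> w1 wP wc; rewrite (multilinear_interpolation a w1 wP).
rewrite (le_trans (sqr_sum_le _))// card_ffun card_bool card_ord natrX exprMn -mulrA.
rewrite ler_wpM2l ?exprn_ge0// mulr_sumr; apply: ler_sum => f _.
rewrite exprMn ler_wpM2r ?sqr_ge0// -exprM mulnC exprM.
have -> : (c ^+ d) ^+ 2 = `|c ^+ d| ^+ 2 by rewrite real_normK ?num_real.
rewrite -real_normK ?num_real// lerXn2r ?nnegrE// normr_prod.
rewrite normrX -[X in _ <= _ ^+ X](card_ord d) -prodr_const.
by apply: ler_prod => i _; rewrite normr_ge0 (le_trans (wc i _))// ler_norm.
Qed.

End multilinear.

(** * Mass bounds for finite element functions *)

Section ae_le_Rintegral.
Context d (T : measurableType d) (R : realType) (m : {measure set T -> \bar R}).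

Lemma ae_ge0_le_Rintegral (f g : T -> R) :
  m.-integrable setT (EFin \o f) -> m.-integrable setT (EFin \o g) ->
  (forall x, 0 <= f x) -> (forall x, 0 <= g x) ->
  {ae m, forall x, f x <= g x} -> \int[m]_x f x <= \int[m]_x g x.
Proof.
move=> fi gi f0 g0 fg; apply: fine_le; [exact: integrable_fin_num..|].
apply: ae_ge0_le_integral => //.
- by move=> x _; rewrite lee_fin.
- exact: (measurable_int m).
- by move=> x _; rewrite lee_fin.
- exact: (measurable_int m).
- by apply: filterS fg => x; rewrite lee_fin.
Qed.

End ae_le_Rintegral.

Section mass.
Context {R : realType} {d : nat}.
Local Notation mu := (@lebesgue_rV R d).
Local Notation V := 'rV[R]_d.

Lemma ae_rV_shift (P : V -> Prop) z :
  {ae mu, forall x, P x} -> {ae mu, forall x, P (x + z)}.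
Proof.
move=> [N [mN N0 PN]]; exists ((fun x => x + z) @^-1` N); split.
- by rewrite -[X in measurable X]setTI; exact: measurable_rV_shift.
- have mNz : measurable ((fun x : V => x + z) @^-1` N).
    by rewrite -[X in measurable X]setTI; exact: measurable_rV_shift.
  transitivity (\int[mu]_x (\1_N (x + z)%R)%:E)%E.
    rewrite (eq_integral (fun x => (\1_((fun x : V => x + z) @^-1` N) x)%:E)).
      by rewrite integral_indic// setIT.
    by move=> x _; rewrite !indicE.
  rewrite (@ge0_integral_rV_shift R d z (fun x => (\1_N x)%:E))//.
    by rewrite integral_indic// setIT.
  by apply/measurable_EFinP; exact/measurable_indicP.
- by move=> x /= /PN.
Qed.

Lemma ge0_integral_sum_shift (I : finType) (z : I -> V) (G : V -> \bar R) :
  measurable_fun setT G -> (forall x, 0 <= G x)%E ->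
  (\int[mu]_x (\sum_i G (x + z i)%R) = #|I|%:R%:E * \int[mu]_x G x)%E.
Proof.
move=> mG G0; rewrite ge0_integral_sum//; last first.
  by move=> i; exact: (measurableT_comp mG (measurable_rV_shift (z i))).
under eq_bigr do rewrite ge0_integral_rV_shift//.
have G1 : (0 <= \int[mu]_x G x)%E by exact: integral_ge0.
by rewrite mule_natl big_const; elim: #|I| => [//|[|k] /= ->]; rewrite ?adde0.
Qed.

Lemma Rintegral_indic_box (l u : V) (r : R) : 0 <= r ->
  (forall i, u ord0 i - l ord0 i = r) ->
  \int[mu]_x (\1_(rV_box l u) x) = r ^+ d.
Proof.
move=> r0 lu; rewrite /Rintegral integral_indic//; last exact: measurable_rV_box.
rewrite setIT [X in fine X]lebesgue_rV_box => [/=|i].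
  by rewrite (eq_bigr (fun=> r))// prodr_const card_ord.
by rewrite -subr_ge0 lu.
Qed.

Lemma integrable_indic_box (l u : V) : (forall i, l ord0 i <= u ord0 i) ->
  mu.-integrable setT (EFin \o \1_(rV_box l u)).
Proof.
move=> lu; apply: ge0_integrable => //.
  by apply/measurable_indicP; exact: measurable_rV_box.
rewrite integral_indic//; last exact: measurable_rV_box.
by rewrite setIT [ltLHS]lebesgue_rV_box// ltry.
Qed.

Variables (h : R) (h0 : 0 < h) (N : nat) (T : 'I_N -> cube R d) (n : nat).
Variables (x : 'I_n -> R) (u w : V -> R).
Hypotheses (hw : sqr_integrable w) (uw : {ae mu, forall y, u y = w y}).

(** Integrate the pointwise bound over the boxes, whose sides are [2 * d * h]. *)
Lemma mass_upper_bound (A : R) (p : 'I_n -> V) : 0 <= A ->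
  (forall y, u y ^+ 2 <= A * \sum_j x j ^+ 2 *
    \1_(rV_box (p j - const_mx (d%:R * h)) (p j + const_mx (d%:R * h))) y) ->
  \int[mu]_y (w y ^+ 2) <= A * (2 * d%:R * h) ^+ d * \sum_j x j ^+ 2.
Proof.
move=> A0 hU.
have dh0 : 0 <= d%:R * h by rewrite mulr_ge0// ltW.
set f := fun j => \1_(rV_box (p j - const_mx (d%:R * h)) (p j + const_mx (d%:R * h))) : V -> R.
have fi j : mu.-integrable setT (EFin \o f j).
  by apply: integrable_indic_box => i; rewrite !mxE; lra.
have fxi j : mu.-integrable setT (EFin \o (fun y => x j ^+ 2 * f j y)).
  by have := integrableZl measurableT (x j ^+ 2) (fi j); exact: eq_integrable.
have si : mu.-integrable setT (EFin \o (fun y => \sum_j x j ^+ 2 * f j y)).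
  exact: integrable_EFin_sum.
have Asi : mu.-integrable setT (EFin \o (fun y => A * \sum_j x j ^+ 2 * f j y)).
  by have := integrableZl measurableT A si; exact: eq_integrable.
apply: (@le_trans _ _ (\int[mu]_y (A * \sum_j x j ^+ 2 * f j y))).
  apply: ae_ge0_le_Rintegral => //; first by case: hw.
  - by move=> y; exact: sqr_ge0.
  - by move=> y; exact: (le_trans (sqr_ge0 _) (hU y)).
  - by apply: filterS uw => y <-.
rewrite RintegralZl// Rintegral_sum// -mulrA ler_wpM2l// mulr_sumr.
apply: ler_sum => j _; rewrite RintegralZl// mulrC ler_wpM2r ?sqr_ge0//.
rewrite /f (Rintegral_indic_box (r := 2 * d%:R * h))//.
  by rewrite -mulrA mulr_ge0.
by move=> i; rewrite !mxE; ring.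
Qed.

(** Each pointwise bound is integrated over a small box whose half-edge translates stay inside the
    element. One factor [2 ^ d] counts the translates, the other how often an element can serve as
    [kk j]; the open elements are disjoint. *)
Lemma mass_lower_bound (B : R) (kk : 'I_n -> 'I_N) : (0 < d)%N -> 0 <= B ->
  conforming_mesh h T -> (forall k, (#|[pred j | kk j == k]| <= 2 ^ d)%N) ->
  (forall j (s : V), (forall i, 0 < s ord0 i < 2^-1) ->
    x j ^+ 2 <= B * \sum_(f : {ffun 'I_d -> bool})
      u (cube_point h (T (kk j)) (pick_row (fun i e => s ord0 i + e%:R / 2) f)) ^+ 2) ->
  (h / (4 * d%:R)) ^+ d * \sum_j x j ^+ 2 <= B * 4 ^+ d * \int[mu]_y (w y ^+ 2).
Proof.
move=> d0 B0 cT kk2 hL.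
have dR : (0 : R) < d%:R by rewrite ltr0n.
set r := h / (4 * d%:R).
have r0 : 0 < r by rewrite divr_gt0// mulr_gt0.
have [mw wi] := hw.
have mw2 : measurable_fun setT (fun y => w y ^+ 2) by exact: measurable_funX.
pose G k y := \1_(open_cube h (T k)) y * w y ^+ 2.
have mG k : measurable_fun setT (G k).
  apply: measurable_funM => //; apply/measurable_indicP; exact: measurable_open_cube.
have G0 k y : 0 <= G k y by rewrite mulr_ge0// sqr_ge0.
have Gi k : mu.-integrable setT (EFin \o G k).
  apply: le_integrable wi => //; first exact/measurable_EFinP.
  move=> y _; rewrite !abse_EFin lee_fin /G normrM ler_piMl// indicE.
  by case: (_ \in _); rewrite ?normr0 ?normr1.
have GE k : (\int[mu]_y (G k y)%:E)%E = (\int[mu]_y G k y)%:E.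
  by rewrite fineK//; exact: (integrable_fin_num measurableT (Gi k)).
(* The axis-parallel box b of side r around the point of local coordinates
   (1/4,..,1/4) lies in the subcube (0,1/2)^d of the element. *)
have step j : r ^+ d * x j ^+ 2 <= B * 2 ^+ d * \int[mu]_y G (kk j) y.
  pose Q := T (kk j).
  have [c cE] : {c : V | c = cube_point h Q (const_mx 4^-1)} by eexists.
  pose b := rV_box (c - const_mx (r / 2)) (c + const_mx (r / 2)).
  have mb : measurable b by exact: measurable_rV_box.
  pose z (f : {ffun 'I_d -> bool}) : V :=
    h *: (pick_row (fun=> fun e => e%:R / 2) f *m frame Q).
  have zE y f : y + z f =
     cube_point h Q (pick_row (fun i e => cube_coord h Q y ord0 i + e%:R / 2) f).
    rewrite -{1}(cube_coordK h0 Q y) /cube_point -addrA -scalerDr -mulmxDl.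
    by congr (_ + _ *: (_ *m _)); apply/rowP => i; rewrite !mxE.
  have sb y : b y -> forall i, 0 < cube_coord h Q y ord0 i < 2^-1.
    move=> yb i; have := @cube_coord_dist _ _ _ h0 Q y c (r / 2) _ i.
    rewrite {2}cE (cube_pointK h0) [const_mx _ _ _]mxE.
    (* The side [r] is chosen for this: local coordinates on the box lie within 1/8 of 1/4, hence
       strictly between 0 and 1/2. *)
    have -> : d%:R * (r / 2) / h = 8^-1 by rewrite /r; field; rewrite !lt0r_neq0.
    have cy k : `|y ord0 k - c ord0 k| <= r / 2.
      have := yb k; rewrite !mxE => /andP[? ?].
      by rewrite ler_norml; apply/andP; split; lra.
    by move=> /(_ cy); rewrite ler_norml => /andP[? ?]; apply/andP; split; lra.
  have ib : mu.-integrable setT (EFin \o \1_b).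
    by apply: integrable_indic_box => i; rewrite !mxE; lra.
  have <- : \int[mu]_y \1_b y = r ^+ d.
    by apply: Rintegral_indic_box => [|i]; [exact: ltW|rewrite !mxE; lra].
  rewrite -lee_fin EFinM [leRHS]EFinM (EFinM B) -GE fineK;
    last exact: (integrable_fin_num measurableT ib).
  rewrite muleC -ge0_integralZl//; last 2 first.
  - by apply/measurable_EFinP; apply/measurable_indicP.
  - by rewrite lee_fin sqr_ge0.
  have -> : (2 ^+ d = #|{ffun 'I_d -> bool}|%:R :> R).
    by rewrite card_ffun card_bool card_ord natrX.
  have mGk : measurable_fun setT (fun y => (G (kk j) y)%:E) by exact/measurable_EFinP.
  rewrite -muleA -(ge0_integral_sum_shift z)//; last by move=> y; rewrite lee_fin.
  rewrite -ge0_integralZl//; last 2 first.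
  - by apply: emeasurable_sum => f;
      exact: (measurableT_comp mGk (measurable_rV_shift (z f))).
  - by move=> y _; apply: sume_ge0 => f _; rewrite lee_fin.
  apply: ae_ge0_le_integral => //.
  - by move=> y _; rewrite mule_ge0// lee_fin ?sqr_ge0.
  - by apply: measurable_funeM; apply/measurable_EFinP; exact/measurable_indicP.
  - by move=> y _; rewrite mule_ge0// sume_ge0// => f _; rewrite lee_fin.
  - apply: measurable_funeM; apply: emeasurable_sum => f.
    exact: (measurableT_comp mGk (measurable_rV_shift (z f))).
  have uwz : {ae mu, forall y, forall f, u (y + z f) = w (y + z f)}.
    by apply: filter_forall => f; exact: ae_rV_shift uw.
  apply: filterS uwz => y uwy _; rewrite sumEFin -!EFinM lee_fin indicE.
  have [/set_mem yb|_] := boolP (y \in b); last first.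
    by rewrite mulr0 mulr_ge0// sumr_ge0.
  rewrite mulr1 (le_trans (hL j _ (sb y yb)))// ler_wpM2l//.
  apply: ler_sum => f _; rewrite -zE uwy /G indicE mem_set ?mul1r//.
  apply/(open_cubeP h0) => i; rewrite zE (cube_pointK h0) mxE.
  by have := sb y yb i; case: (f i) => /=; lra.
have Gs : \sum_j \int[mu]_y G (kk j) y <= 2 ^+ d * \int[mu]_y (w y ^+ 2).
  rewrite -Rintegral_sum// -RintegralZl//.
  apply: le_Rintegral => //.
  - exact: integrable_EFin_sum.
  - by have := integrableZl measurableT (2 ^+ d) wi; exact: eq_integrable.
  move=> y _; rewrite /G -mulr_suml ler_wpM2r ?sqr_ge0//.
  have [[k ky]|nk] := pselect (exists k, open_cube h (T k) y); last first.
    rewrite big1 ?exprn_ge0// => j _; rewrite indicE memNset// => yj.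
    by apply: nk; exists (kk j).
  rewrite (eq_bigr (fun j => (kk j == k)%:R)) => [|j _]; last first.
    rewrite indicE; congr (_%:R); congr nat_of_bool; apply/idP/eqP => [/set_mem yj|->].
      apply/esym; apply: conforming_mesh_open_disjoint cT ky _ => //.
      exact: open_closed_cube.
    exact: mem_set.
  rewrite -natr_sum -natrX ler_nat (leq_trans _ (kk2 k))//.
  by rewrite -sum1_card [leqRHS]big_mkcond/=; apply: leq_sum => j _; rewrite inE; case: eqP.
rewrite mulr_sumr (le_trans (ler_sum _ (fun j _ => step j)))// -mulr_sumr.
rewrite (_ : 4 = 2 * 2); last by rewrite -natrM.
rewrite exprMn mulrA -[leRHS]mulrA ler_wpM2l// mulr_ge0// exprn_ge0//.
Qed.

End mass.

Section finite_elements.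
Context {R : realType} {d : nat}.
Local Notation V := 'rV[R]_d.
Variables (h : R) (h0 : 0 < h) (N : nat) (T : 'I_N -> cube R d).
Hypothesis cT : conforming_mesh h T.
Variables (n : nat) (phi : 'I_n -> V -> R).
Hypothesis phi_inj : injective phi.

(* kk j is an element on which phi j does not vanish, and p j is the point around
   which phi j is supported; the last bound recovers x j from the values
   of the sum at the 2^d translates by half-edges of any point of the subcube
   (0,1/2)^d of that element. *)
Definition fe_bounds (kk : 'I_n -> 'I_N) (p : 'I_n -> V) :=
  [/\ forall k, (#|[pred j | kk j == k]| <= 2 ^ d)%N,
      forall (x : 'I_n -> R) y, (\sum_j x j * phi j y) ^+ 2 <=
        4 ^+ d * \sum_j x j ^+ 2 *
        \1_(rV_box (p j - const_mx (d%:R * h)) (p j + const_mx (d%:R * h))) y &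
      forall (x : 'I_n -> R) j (s : V), (forall i, 0 < s ord0 i < 2^-1) ->
        x j ^+ 2 <= 8 ^+ d * \sum_(f : {ffun 'I_d -> bool})
          (\sum_l x l * phi l (cube_point h (T (kk j))
             (pick_row (fun i e => s ord0 i + e%:R / 2) f))) ^+ 2].

(** At most one term survives, so squaring the sum squares a single coefficient. *)
Lemma sum_delta (I : finType) (x : I -> R) (P : pred I) :
  (forall i j, P i -> P j -> i = j) ->
  (\sum_j x j * (P j)%:R) ^+ 2 = \sum_j x j ^+ 2 * (P j)%:R.
Proof.
move=> Puniq; have [i Pi|P0] := pickP P; last first.
  by rewrite !big1 ?expr0n// => j _; rewrite P0 mulr0.
have Pj j : j != i -> P j = false.
  by move=> ji; apply/negP => /Puniq/(_ Pi) ?; subst; rewrite eqxx in ji.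
have s0 (y : I -> R) : \sum_j y j * (P j)%:R = y i.
  by rewrite (bigD1 i)//= Pi mulr1 big1 ?addr0// => j /Pj ->; rewrite mulr0.
by rewrite !s0.
Qed.

Lemma closed_cube_box (Q : cube R d) (y z : V) : closed_cube h Q y -> closed_cube h Q z ->
  rV_box (z - const_mx (d%:R * h)) (z + const_mx (d%:R * h)) y.
Proof.
move=> [t t01 <-] [s s01 <-] i.
have ts k : `|t ord0 k - s ord0 k| <= 1.
  have /andP[? ?] := t01 k; have /andP[? ?] := s01 k.
  by rewrite ler_norml; apply/andP; split; lra.
have := cube_point_dist h0 Q ts i; rewrite mulr1 ler_norml.
move: (cube_point h Q t) (cube_point h Q s) => y' z'; rewrite !mxE.
by move=> /andP[? ?]; apply/andP; split; lra.
Qed.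

(** Here [phi j] is the indicator of one open element, and distinct indices have distinct elements.
    The constants are generous so as to be shared with the piecewise linear case. *)
Lemma fe_bounds_constant :
  (forall j, shape_function h T PiecewiseConstant (phi j)) ->
  exists kk p, fe_bounds kk p.
Proof.
move=> sphi.
have /choice[kk kkP] j : exists k, forall l y, open_cube h (T l) y -> phi j y = (l == k)%:R.
  by have [_ []] := sphi j => k kP; exists k.
have phi0 j y : (forall k, ~ open_cube h (T k) y) -> phi j y = 0.
  by have [[_ +] _] := sphi j; exact.
have kk_inj : injective kk.
  move=> i j ij; apply: phi_inj; apply/funext => y.
  have [[k yk]|yk] := pselect (exists k, open_cube h (T k) y).
    by rewrite !(kkP _ _ _ yk) ij.
  by rewrite !phi0// => k ky; apply: yk; exists k.
have sE (x : 'I_n -> R) y k : open_cube h (T k) y ->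
    (\sum_j x j * phi j y) ^+ 2 = \sum_j x j ^+ 2 * (k == kk j)%:R.
  move=> yk; under eq_bigr do rewrite (kkP _ _ _ yk).
  apply: sum_delta => i j /eqP-> /eqP; exact: kk_inj.
exists kk, (fun j => corner (T (kk j))); split.
- move=> k; apply: (@leq_trans 1); last by rewrite expn_gt0.
  apply/card_le1P => i; rewrite inE => /eqP ik j; rewrite !inE -ik.
  by apply/eqP/eqP => [/kk_inj//|->].
- move=> x y.
  have c1 : (1 : R) <= 4 ^+ d by rewrite exprn_ege1// ler1n.
  have [[k yk]|yk] := pselect (exists k, open_cube h (T k) y); last first.
    rewrite big1 ?expr0n ?mulr_ge0 ?exprn_ge0 ?sumr_ge0// => [j _|j _].
      by rewrite mulr_ge0 ?sqr_ge0.
    by rewrite phi0 ?mulr0// => k ky; apply: yk; exists k.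
  rewrite (sE _ _ _ yk); apply: le_trans (ler_peMl _ c1); last first.
    by apply: sumr_ge0 => j _; rewrite mulr_ge0 ?sqr_ge0.
  apply: ler_sum => j _; rewrite ler_wpM2l ?sqr_ge0//.
  case: eqP => [kj|_]; last by [].
  rewrite indicE mem_set//; apply: (@closed_cube_box (T k)).
    exact: open_closed_cube.
  rewrite kj; exists 0; first by move=> i; rewrite mxE lexx ler01.
  by rewrite /cube_point mul0mx scaler0 addr0.
- move=> x j s s01.
  (* All [2 ^ d] translates stay in the open element of [j], where the sum is just [x j]. *)
  rewrite (eq_bigr (fun=> x j ^+ 2)) => [|f _].
    rewrite sumr_const card_ffun card_bool card_ord -[_ *+ (2 ^ d)]mulr_natl mulrA.
    rewrite ler_peMl ?sqr_ge0//.
    by rewrite natrX mulr_ege1// exprn_ege1// ler1n.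
  rewrite (sE _ _ (kk j)); last first.
    apply/(open_cubeP h0) => i; rewrite (cube_pointK h0) mxE.
    by have /andP[? ?] := s01 i; case: (f i) => /=; apply/andP; split; lra.
  rewrite (bigD1 j)//= eqxx mulr1 big1 ?addr0// => l lj.
  by rewrite eq_sym (inj_eq kk_inj) (negbTE lj) mulr0.
Qed.

(** Each shape function is attached to its node [p j], and [kb j] records an element with that node
    among its vertices, and which vertex it is. Different nodes of one element are different
    vertices, so at most [2 ^ d] indices share an element. *)
Lemma fe_bounds_linear :
  (forall j, shape_function h T PiecewiseLinear (phi j)) ->
  exists kk p, fe_bounds kk p.
Proof.
move=> sphi.
have /choice[a aP] j : exists a : 'I_N -> {set 'I_d} -> R, forall k (t : V),
    (forall i, 0 <= t ord0 i <= 1) -> phi j (cube_point h (T k) t) = multilinear (a k) t.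
  by have [[/choice[a aP] _] _] := sphi j; exists a.
have phi0 j y : (forall k, ~ closed_cube h (T k) y) -> phi j y = 0.
  by have [[_ +] _] := sphi j; exact.
have /choice[p pP] j : exists p, node h T p /\ forall q, node h T q -> phi j q = (q == p)%:R.
  by have [_ [p ? ?]] := sphi j; exists p.
have /choice[kb kbP] j : exists kb : 'I_N * {ffun 'I_d -> bool},
    p j = cube_point h (T kb.1) (pick_row (fun=> fun e => e%:R) kb.2).
  have [[k _ [b _ <-]] _] := pP j; exists (k, [ffun i => b i]).
  by congr cube_point; apply/rowP => i; rewrite !mxE ffunE.
have vnode k (f : {ffun 'I_d -> bool}) :
    node h T (cube_point h (T k) (pick_row (fun=> fun e => e%:R) f)).
  by exists k => //; exists f.
have interp j k (t : V) : (forall i, 0 <= t ord0 i <= 1) ->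
    phi j (cube_point h (T k) t) = \sum_(f : {ffun 'I_d -> bool})
     \prod_i (if f i then t ord0 i else 1 - t ord0 i) *
      phi j (cube_point h (T k) (pick_row (fun=> fun e => e%:R) f)).
  move=> t01; rewrite aP// (multilinear_interpolation _
    (w := fun i (e : bool) => if e then t ord0 i else 1 - t ord0 i)
    (P := fun=> fun e => e%:R)).
  - apply: eq_bigr => f _; rewrite aP// => i; rewrite mxE.
    by case: (f i); rewrite ?lexx ?ler01.
  - by move=> i; rewrite addrC subrK.
  - by move=> i; rewrite mulr1 mulr0 addr0.
(* Interpolation from the vertices shows that nodal values determine a shape function. *)
have p_inj : injective p.
  move=> i j ij; apply: phi_inj; apply/funext => y.
  have [[k [t t01 <-]]|yk] := pselect (exists k, closed_cube h (T k) y); last first.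
    by rewrite !phi0// => k ky; apply: yk; exists k.
  rewrite !interp//; apply: eq_bigr => f _.
  by rewrite (pP i).2// (pP j).2// ij.
have sE (x : 'I_n -> R) q : node h T q ->
    (\sum_j x j * phi j q) ^+ 2 = \sum_j x j ^+ 2 * (q == p j)%:R.
  move=> nq; under eq_bigr do rewrite (pP _).2//.
  by apply: sum_delta => i j /eqP-> /eqP; exact: p_inj.
have uE (x : 'I_n -> R) k : exists c, forall t : V, (forall i, 0 <= t ord0 i <= 1) ->
    \sum_j x j * phi j (cube_point h (T k) t) = multilinear c t.
  exists (fun J => \sum_j x j * a j k J) => t t01.
  rewrite /multilinear; under [RHS]eq_bigr do rewrite mulr_suml.
  rewrite exchange_big/=; apply: eq_bigr => j _; rewrite aP// mulr_sumr.
  by apply: eq_bigr => J _; rewrite mulrA.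
exists (fun j => (kb j).1), p; split.
- move=> k; rewrite -card_bool -[X in (_ ^ X)%N]card_ord -card_ffun.
  rewrite -(@card_in_imset _ _ (fun j => (kb j).2)); first exact: max_card.
  move=> i j; rewrite !inE => /eqP ik /eqP jk ij; apply: p_inj.
  by rewrite !kbP ik jk ij.
- move=> x y.
  have [[k yk]|yk] := pselect (exists k, closed_cube h (T k) y); last first.
    rewrite big1 ?expr0n ?mulr_ge0 ?exprn_ge0 ?sumr_ge0// => [j _|j _].
      by rewrite mulr_ge0 ?sqr_ge0.
    by rewrite phi0 ?mulr0// => k ky; apply: yk; exists k.
  have [t t01 ty] := yk; have [c cP] := uE x k.
  rewrite -{1}ty cP//.
  (* Interpolation from the vertices has weights in [[0, 1]], so [c = 1] and one factor [2 ^ d]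
     arises; bounding the [2 ^ d] vertex values alike gives the other. *)
  apply: le_trans (multilinear_sqr_le _
    (w := fun i (e : bool) => if e then t ord0 i else 1 - t ord0 i)
    (P := fun=> fun e => e%:R) (c := 1) _ _ _) _.
  - by move=> i; rewrite addrC subrK.
  - by move=> i; rewrite mulr1 mulr0 addr0.
  - move=> i e; have /andP[? ?] := t01 i.
    by case: e; rewrite ler_norml; apply/andP; split; lra.
  rewrite expr1n mulr1 (_ : 4 = 2 * 2); last by rewrite -natrM.
  rewrite exprMn -mulrA ler_wpM2l ?exprn_ge0//.
  apply: (@le_trans _ _ (\sum_(f : {ffun 'I_d -> bool}) \sum_j x j ^+ 2 *
     \1_(rV_box (p j - const_mx (d%:R * h)) (p j + const_mx (d%:R * h))) y)); last first.
    by rewrite sumr_const card_ffun card_bool card_ord -[_ *+ (2 ^ d)]mulr_natl natrX.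
  apply: ler_sum => f _; rewrite -cP => [|i]; last first.
    by rewrite mxE; case: (f i); rewrite ?lexx ?ler01.
  rewrite sE//; apply: ler_sum => j _; rewrite ler_wpM2l ?sqr_ge0//.
  case: eqP => [pj|_]; last by [].
  rewrite indicE mem_set//; apply: closed_cube_box yk _; rewrite -pj.
  exists (pick_row (fun=> fun e => e%:R) f) => // i.
  by rewrite mxE; case: (f i); rewrite ?lexx ?ler01.
- move=> x j s s01.
  have [c cP] := uE x (kb j).1.
  (* The coefficient [x j] is the value of the sum at the node [p j]. *)
  have {1}-> : x j ^+ 2 = (\sum_l x l * phi l (p j)) ^+ 2.
    rewrite sE; last by case: (pP j).
    rewrite (bigD1 j)//= eqxx mulr1 big1 ?addr0// => l lj.
    by rewrite eq_sym (inj_eq p_inj) (negbTE lj) mulr0.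
  rewrite kbP cP => [|i]; last by rewrite mxE; case: (_ i); rewrite ?lexx ?ler01.
  (* The value at a vertex is extrapolated, in each coordinate, from s i and
     s i + 1/2, with weights at most 2. *)
  rewrite (_ : 8 = 2 * 2 ^+ 2); last by rewrite -natrX -natrM.
  apply: le_trans (multilinear_sqr_le _
    (w := fun i e => if e then 2 * (((kb j).2 i)%:R - s ord0 i)
                     else 1 - 2 * (((kb j).2 i)%:R - s ord0 i))
    (P := fun i e => s ord0 i + e%:R / 2) (c := 2) _ _ _) _.
  - by move=> i; rewrite addrC subrK.
  - by move=> i; rewrite mxE mulr1n/=; field.
  - move=> i e; have /andP[? ?] := s01 i; rewrite ler_norml.
    by case: ((kb j).2 i); case: e; rewrite /=; apply/andP; split; lra.
  rewrite ler_wpM2l ?exprn_ge0// ?mulr_ge0 ?exprn_ge0//.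
  apply: ler_sum => f _; rewrite -cP// => i; rewrite mxE.
  by have /andP[? ?] := s01 i; case: (f i) => /=; apply/andP; split; lra.
Qed.

End finite_elements.

(** * Eigenvalues of the stiffness matrix *)

Section cond_number.
Context {R : realType} {n : nat}.

Lemma sumsq_gt0 (x : 'rV[R]_n) : x != 0 -> 0 < \sum_i x ord0 i ^+ 2.
Proof.
move=> x0; rewrite lt_neqAle sumr_ge0 ?andbT => [|i _]; last exact: sqr_ge0.
apply: contra x0; rewrite eq_sym psumr_eq0 => [/allP xi|i _]; last exact: sqr_ge0.
apply/eqP/rowP => i; rewrite mxE; apply/eqP.
by have := xi i; rewrite mem_index_enum sqrf_eq0 => /(_ isT).
Qed.

(** Evaluating the quadratic form at an eigenvector confines every eigenvalue to [[a, b]]. *)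
Lemma cond_number_le (K : 'M[R]_n) (a b : R) : 0 < a -> 0 <= b ->
  (forall x : 'rV[R]_n, a * \sum_i x ord0 i ^+ 2 <= (x *m K *m x^T) ord0 ord0
     <= b * \sum_i x ord0 i ^+ 2) ->
  cond_number K <= b / a.
Proof.
move=> a0 b0 Kab; rewrite /cond_number.
have Eab e : eigenvalue K e -> a <= e <= b.
  move=> /eigenvalueP[v vK /sumsq_gt0 v0].
  have := Kab v; rewrite vK -scalemxAl mxE.
  have -> : (v *m v^T) ord0 ord0 = \sum_i v ord0 i ^+ 2.
    by rewrite mxE; apply: eq_bigr => i _; rewrite mxE expr2.
  by rewrite !ler_pM2r.
(* If there is no eigenvalue, as for [n = 0], the supremum is 0 by default and so is the
   quotient. *)
have [E0|/set0P[e Ke]] := eqVneq [set e | eigenvalue K e] set0.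
  by rewrite E0 sup0 mul0r divr_ge0// ltW.
have supb : sup [set e | eigenvalue K e] <= b.
  by apply: ge_sup => [|c /Eab/andP[]//]; exists e.
have infa : a <= inf [set e | eigenvalue K e].
  by apply: lb_le_inf => [|c /Eab/andP[]//]; exists e.
rewrite (@le_trans _ _ (b / inf [set e | eigenvalue K e]))//.
  by rewrite ler_wpM2r// invr_ge0 (le_trans (ltW a0)).
by rewrite ler_wpM2l// lef_pV2 ?posrE// (lt_le_trans a0).
Qed.

Lemma sym_posdef_ge (K : 'M[R]_n) (a : R) : 0 < a -> K^T = K ->
  (forall x : 'rV[R]_n, a * \sum_i x ord0 i ^+ 2 <= (x *m K *m x^T) ord0 ord0) ->
  sym_posdef K.
Proof.
move=> a0 KT Ka; split=> // x x0; apply: lt_le_trans (Ka x).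
by rewrite mulr_gt0// sumsq_gt0.
Qed.

End cond_number.

(** The powers come from the box of side [h / (4 * d)], the extrapolation bound [8 ^+ d] in
    [fe_bounds], and the two counts in [mass_lower_bound]. *)
Definition mass_lower (R : realType) (d : nat) : R :=
  (4 * d%:R)^-1 ^+ d / (8 ^+ d * 4 ^+ d).

(** The bound [4 ^+ d] in [fe_bounds] times the volume of a box of side [2 * d * h], without its
    [h ^+ d]. *)
Definition mass_upper (R : realType) (d : nat) : R := 4 ^+ d * (2 * d%:R) ^+ d.

Lemma mass_lower_gt0 (R : realType) (d : nat) : (0 < d)%N -> 0 < mass_lower R d.
Proof.
move=> d0; rewrite divr_gt0 ?mulr_gt0 ?exprn_gt0//.
by rewrite invr_gt0 mulr_gt0// ltr0n.
Qed.

Lemma mass_upper_gt0 (R : realType) (d : nat) : (0 < d)%N -> 0 < mass_upper R d.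
Proof. by move=> d0; rewrite mulr_gt0 ?exprn_gt0// mulr_gt0// ltr0n. Qed.

(** * Bounds for the Rayleigh quotient and the stiffness matrix *)

Section nonlocal.
Context {R : realType} {d : nat}.
Local Notation mu := (@lebesgue_rV R d).
Local Notation mu2 := (mu \x mu)%E.
Local Notation V := 'rV[R]_d.

Lemma bounded_domain_coord (Om : set V) : bounded_domain Om ->
  exists2 M : R, 0 <= M & forall x, Om x -> forall i, `|x ord0 i| <= M.
Proof.
(* A bounded set is bounded by every real above [M]; this one is also nonnegative. *)
move=> [_ _ _ [M [_ OmM]]]; exists (`|M| + 1); first by rewrite addr_ge0.
move=> x Omx i; apply: le_trans (coord_le_norm x i) _.
by apply: (OmM (`|M| + 1)) => //; rewrite ltr_pwDr// ler_norm.
Qed.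

Section fixed.
Variables (Om : set V) (M delta : R) (i0 : 'I_d).
Hypotheses (bOm : bounded_domain Om) (M0 : 0 <= M)
  (OmM : forall x, Om x -> forall i, `|x ord0 i| <= M)
  (delta0 : 0 < delta) (delta1 : delta <= 1).

Let oOm : open Om. Proof. by case: bOm. Qed.
Let Om0 : Om !=set0. Proof. by case: bOm. Qed.

Lemma L20_sqr_integrable u : L20 delta Om u -> sqr_integrable (u \_ Om).
Proof.
move=> hu; apply: (sqr_integrable_patch oOm Om0 _ _ hu); first exact: open_rV_measurable.
by move=> x; left.
Qed.

Lemma rayleigh_bounds (w : V -> R) : sqr_integrable w -> (forall x, ~ Om x -> w x = 0) ->
  poincare_cst d M * delta ^+ (d + 2) * \int[mu]_x (w x ^+ 2) <=
  2^-1 * \int[mu2]_p nl_integrand delta w w p <=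
  2 * 2 ^+ d * delta ^+ d * \int[mu]_x (w x ^+ 2).
Proof.
move=> hw wOm; apply/andP; split.
  apply: (nl_integrand_ge (i0 := i0)) => // x xM; apply: wOm => /OmM/(_ i0).
  by rewrite leNgt xM.
by have := nl_integrand_le (ltW delta0) hw; rewrite exprMn mulrA.
Qed.

(** A zero norm forces [u] to vanish almost everywhere in [Om], and the boundary condition extends
    this to the closure. *)
Lemma L2_normsq_gt0 u : L20 delta Om u -> ~ L2_null delta Om u ->
  0 < L2_normsq delta Om u.
Proof.
move=> hu unull; have [mw wi] := L20_sqr_integrable hu.
rewrite (L2_normsqE oOm Om0 hu) lt_neqAle; apply/andP; split; last first.
  by apply: Rintegral_ge0 => x _; exact: sqr_ge0.
apply/eqP => I0; apply: unull.
have : (\int[mu]_x `|((u \_ Om) x ^+ 2)%:E| = 0)%E.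
  rewrite [RHS](congr1 EFin I0) fineK; last exact: integrable_fin_num.
  by apply: eq_integral => x _; rewrite gee0_abs// lee_fin sqr_ge0.
move/(ae_eq_integral_abs mu measurableT (measurable_int mu wi)) => w0.
apply: filterS2 w0 (L20_ae hu) => x w0 uw Sx.
move: uw; rewrite patchE mem_set// => ->.
by have [] := w0 I => /eqP; rewrite sqrf_eq0 => /eqP.
Qed.

Lemma rayleigh_quotient_bounds u : L20 delta Om u -> ~ L2_null delta Om u ->
  poincare_cst d M * delta ^+ (d + 2) <=
  nl_form delta Om u u / L2_normsq delta Om u <= 2 * 2 ^+ d * delta ^+ d.
Proof.
move=> hu unull; have I0 := L2_normsq_gt0 hu unull.
rewrite ler_pdivlMr// ler_pdivrMr// L2_normsqE// nl_formE//; last exact: ltW.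
apply: rayleigh_bounds; first exact: L20_sqr_integrable.
by move=> x Omx; rewrite patchE memNset.
Qed.

Section stiffness.
Variables (h : R) (N : nat) (T : 'I_N -> cube R d) (kind : fe_kind) (n : nat)
  (phi : 'I_n -> V -> R).
Hypotheses (h0 : 0 < h) (cT : conforming_mesh h T)
  (bphi : standard_basis h T delta Om kind phi).

Let d0 : (0 < d)%N. Proof. exact: leq_ltn_trans (ltn_ord i0). Qed.
Let phiP j : shape_function h T kind (phi j) /\ fe_space0 h T delta Om kind (phi j).
Proof. by case: bphi => /(_ j); rewrite /= => /(_ I). Qed.
Let phiL j : L20 delta Om (phi j). Proof. by case: (phiP j) => _ []. Qed.

(** The finite element function with coefficients [x], cut off to [Om]; the cut-off changes it only
    on a null set. *)
Let w (x : 'rV[R]_n) y := \sum_j x ord0 j * (phi j \_ Om) y.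

Lemma mass_bounds (x : 'rV[R]_n) :
  mass_lower R d * h ^+ d * \sum_j x ord0 j ^+ 2 <= \int[mu]_y (w x y ^+ 2) <=
  mass_upper R d * h ^+ d * \sum_j x ord0 j ^+ 2.
Proof.
have phi_inj : injective phi.
  by case: bphi => _ inj _ i j ij; apply: inj => //; rewrite inE.
have [kk [p [kk2 hU hL]]] : exists kk p, fe_bounds h T phi kk p.
  case: kind phiP => sphi.
    by apply: fe_bounds_constant => // j; case: (sphi j).
  by apply: fe_bounds_linear => // j; case: (sphi j).
have hw : sqr_integrable (w x).
  apply: sqr_integrable_sum => j; apply: sqr_integrableZ.
  exact: L20_sqr_integrable.
have uw : {ae mu, forall y, \sum_j x ord0 j * phi j y = w x y}.
  (* Off the closure this is the last condition of [fe_space0], on the nonlocal boundary the one in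
     [L20]. *)
  have phiw : {ae mu, forall y, forall j, phi j y = (phi j \_ Om) y}.
    apply: filter_forall => j; have [_ [_ _ out]] := phiP j.
    apply: filterS2 out (L20_ae (phiL j)) => y out <-; rewrite patchE.
    by case: ifPn => // /negP Sy; apply: out => /mem_set.
  by apply: filterS phiw => y yw; apply: eq_bigr => j _; rewrite yw.
have c1 : (0 : R) < 8 ^+ d * 4 ^+ d by rewrite mulr_gt0// exprn_gt0.
apply/andP; split.
  have := mass_lower_bound h0 hw uw d0 (exprn_ge0 d (ler0n R 8)) cT kk2 (hL _).
  rewrite -ler_pdivrMl// /mass_lower; apply: le_trans.
  by rewrite mulrA expr_div_n exprVn le_eqVlt; apply/orP; left; apply/eqP; ring.
have := mass_upper_bound h0 hw uw (exprn_ge0 d (ler0n R 4)) (hU _).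
by rewrite /mass_upper !exprMn !mulrA.
Qed.

Lemma stiffness_quadratic_form (x : 'rV[R]_n) :
  (x *m stiffness delta Om phi *m x^T) ord0 ord0 =
  2^-1 * \int[mu2]_p nl_integrand delta (w x) (w x) p.
Proof.
rewrite (Rintegral_nl_integrand_sum (fun j => x ord0 j) (ltW delta0)); last first.
  by move=> j; exact: L20_sqr_integrable.
rewrite mxE; under eq_bigr do rewrite mxE mulr_suml.
rewrite exchange_big/= mulr_sumr; apply: eq_bigr => i _.
rewrite mulr_sumr; apply: eq_bigr => j _; rewrite !mxE nl_formE//; last exact: ltW.
by ring.
Qed.

(** Both bounds carry [h ^+ d], which cancels in the condition number; [delta ^+ d] against
    [delta ^+ (d + 2)] leaves [delta ^- 2]. *)
Lemma stiffness_bounds (x : 'rV[R]_n) :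
  poincare_cst d M * delta ^+ (d + 2) * (mass_lower R d * h ^+ d) * \sum_j x ord0 j ^+ 2 <=
  (x *m stiffness delta Om phi *m x^T) ord0 ord0 <=
  2 * 2 ^+ d * delta ^+ d * (mass_upper R d * h ^+ d) * \sum_j x ord0 j ^+ 2.
Proof.
have hw : sqr_integrable (w x).
  apply: sqr_integrable_sum => j; apply: sqr_integrableZ.
  exact: L20_sqr_integrable.
have wOm y : ~ Om y -> w x y = 0.
  by move=> Omy; rewrite /w big1// => j _; rewrite patchE memNset// mulr0.
have /andP[l1 l2] := rayleigh_bounds hw wOm; have /andP[m1 m2] := mass_bounds x.
rewrite stiffness_quadratic_form; apply/andP; split.
  apply: le_trans l1; rewrite -[leLHS]mulrA ler_wpM2l// mulr_ge0 ?exprn_ge0 ?ltW//.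
  exact: poincare_cst_gt0.
apply: le_trans l2 _; rewrite -[leRHS]mulrA ler_wpM2l// !mulr_ge0 ?exprn_ge0//.
exact: ltW.
Qed.

Lemma tr_stiffness : (stiffness delta Om phi)^T = stiffness delta Om phi.
Proof.
apply/matrixP => i j; rewrite !mxE /nl_form; congr (_ * _).
apply: eq_Rintegral => y _; apply: eq_Rintegral => z _; exact: mulrAC.
Qed.

Lemma stiffness_cond :
  sym_posdef (stiffness delta Om phi) /\
  cond_number (stiffness delta Om phi) <=
    2 * 2 ^+ d * mass_upper R d / (poincare_cst d M * mass_lower R d) * delta ^- 2.
Proof.
have p0 : 0 < poincare_cst d M by exact: poincare_cst_gt0.
have m0 : 0 < mass_lower R d by exact: mass_lower_gt0.
have u0 : 0 < mass_upper R d by exact: mass_upper_gt0.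
have a0 : 0 < poincare_cst d M * delta ^+ (d + 2) * (mass_lower R d * h ^+ d).
  by do !apply: mulr_gt0 => //; exact: exprn_gt0.
split.
  apply: (sym_posdef_ge a0 tr_stiffness) => x.
  by have /andP[] := stiffness_bounds x.
apply: le_trans (cond_number_le a0 _ stiffness_bounds) _.
  by apply: ltW; do !apply: mulr_gt0 => //; exact: exprn_gt0.
rewrite exprD le_eqVlt; apply/orP; left; apply/eqP.
field; rewrite !lt0r_neq0 ?exprn_gt0//.
Qed.

End stiffness.
End fixed.
End nonlocal.

Theorem theorem1 (R : realType) (d : nat) (hd : (0 < d)%N) :
  exists2 lbar : R, 0 < lbar &
  forall Om : set 'rV[R]_d, bounded_domain Om ->
  exists lref C delta0 : R, [/\ 0 < lref, 0 < C, 0 < delta0 &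
  forall delta : R, 0 < delta -> delta < delta0 ->
    (forall u : 'rV[R]_d -> R, L20 delta Om u -> ~ L2_null delta Om u ->
       lref * delta ^+ (d + 2) <=
         nl_form delta Om u u / L2_normsq delta Om u
         <= lbar * delta ^+ d) /\
    (forall (h : R) (N : nat) (T : 'I_N -> cube R d) (kind : fe_kind)
            (n : nat) (phi : 'I_n -> 'rV[R]_d -> R),
       0 < h -> conforming_mesh h T ->
       standard_basis h T delta Om kind phi ->
       sym_posdef (stiffness delta Om phi) /\
       cond_number (stiffness delta Om phi) <= C * delta ^- 2)].
Proof.
(* The upper constant is fixed before [Om] and depends on [d] alone. *)
exists (2 * 2 ^+ d); first by rewrite mulr_gt0// exprn_gt0.
move=> Om bOm; have [M M0 OmM] := bounded_domain_coord bOm.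
have p0 : 0 < poincare_cst d M by exact: poincare_cst_gt0.
(* The domain enters only through [M]. The threshold 1 supplies the bound [delta <= 1] of the
   Poincare inequality. *)
exists (poincare_cst d M),
  (2 * 2 ^+ d * mass_upper R d / (poincare_cst d M * mass_lower R d)), 1; split => //.
  have [l0 u0] := (mass_lower_gt0 R hd, mass_upper_gt0 R hd).
  by apply: divr_gt0; do !apply: mulr_gt0 => //; exact: exprn_gt0.
move=> delta delta0 delta1; split=> [u hu unull|h N T kind n phi h0 cT bphi].
  exact: (rayleigh_quotient_bounds (Ordinal hd) bOm M0 OmM delta0 (ltW delta1)).
exact: (stiffness_cond (Ordinal hd) bOm M0 OmM delta0 (ltW delta1) h0 cT bphi).
Qed.
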